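(* Let $n \geq 3$ and let $\mathcal{R}$ be a countable (not necessarily commutative) ring with unit and of characteristic $0$. Then the first $\ell^2$-Betti number of $\mathrm{EL}_n(\mathcal{R})$ vanishes: $\beta_1(\mathrm{EL}_n(\mathcal{R})) = 0$.
   Context: $\mathrm{EL}_n(\mathcal{R})$ is the group of $n \times n$ matrices over $\mathcal{R}$ generated by the elementary matrices $E_{i,j}(r)$, $r \in \mathcal{R}$, $1 \leq i \neq j \leq n$, where $E_{i,j}(r)$ has $1$'s on the diagonal, $r$ in the $(i,j)$ entry, and $0$ elsewhere. It is viewed as a discrete group. $\beta_1(\Gamma)$ denotes the first $\ell^2$-Betti number of a group $\Gamma$. *)

(* Defs.v *)
From HB Require Import structures.
From mathcomp Require Import all_boot all_order all_algebra finmap complex.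
From mathcomp Require Import all_classical all_reals all_analysis.
From mathcomp Require Import ring.

Set Implicit Arguments.
Unset Strict Implicit.
Unset Printing Implicit Defensive.
Import Order.TTheory GRing.Theory Num.Theory.

Local Open Scope classical_set_scope.
Local Open Scope ring_scope.
Local Open Scope quotient_scope.

Section LmodQuotient.
Variables (S : pzRingType) (V : lmodType S) (P : {pred V}).
Variable subP : submod_closed P.

Definition lmod_quot_pred of submod_closed P : {pred V} := P.

HB.instance Definition _ :=
  GRing.isSubmodClosed.Build S V (lmod_quot_pred subP) subP.

Definition lmod_quot : Type := Quotient.quot (lmod_quot_pred subP).

HB.instance Definition _ := GRing.Zmodule.on lmod_quot.

Local Notation pi := (\pi_(Quotient.quot (lmod_quot_pred subP))).

Let scaleq (a : S) (x : lmod_quot) : lmod_quot := pi (a *: repr x).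

Let pi_scale (a : S) (x : V) :
  pi (a *: x) = scaleq a (pi x).
Proof.
apply/eqP; rewrite -Quotient.idealrBE -scalerBr rpredZ //.
by rewrite Quotient.idealrBE reprK.
Qed.

Let scaleqA a b v : scaleq a (scaleq b v) = scaleq (a * b) v.
Proof. by elim/quotW: v => v; rewrite -(pi_scale b) -!pi_scale scalerA. Qed.

Let scale1q : left_id 1 scaleq.
Proof. by elim/quotW=> v; rewrite -(pi_scale 1) scale1r. Qed.

Let scaleqDr : right_distributive scaleq +%R.
Proof.
move=> a u v; elim/quotW: u => u; elim/quotW: v => v.
by rewrite -raddfD -!(pi_scale a) scalerDr raddfD.
Qed.

Let scaleqDl v : {morph scaleq^~ v : a b / a + b}.
Proof.
elim/quotW: v => v a b.
by rewrite -(pi_scale a) -(pi_scale b) -(pi_scale (a + b)) scalerDl raddfD.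
Qed.

HB.instance Definition _ := GRing.Zmodule_isLmodule.Build S lmod_quot
  scaleqA scale1q scaleqDr scaleqDl.

End LmodQuotient.

Definition complex_sqnorm (R : realType) (z : R[i]) : R :=
  complex.Re z ^+ 2 + complex.Im z ^+ 2.

Section SquareSummable.
Variables (R : realType) (G : groupType).

Local Notation fctG := (G -> (R[i])^o).

Definition l2_sqnorm (f : fctG) : \bar R :=
  \esum_(x in [set: G]) (complex_sqnorm (f x))%:E.

Definition square_summable : {pred fctG} :=
  fun f => `[< (l2_sqnorm f < +oo)%E >].

Lemma complex_sqnorm_ge0 (z : R[i]) : 0 <= complex_sqnorm z.
Proof. by rewrite addr_ge0 ?sqr_ge0. Qed.

Lemma complex_sqnormM (z w : R[i]) :
  complex_sqnorm (z * w) = complex_sqnorm z * complex_sqnorm w.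
Proof. case: z w => [a b] [c d]; rewrite /complex_sqnorm /=; ring. Qed.

Lemma complex_sqnormD_le (z w : R[i]) :
  complex_sqnorm (z + w) <= 2 * complex_sqnorm z + 2 * complex_sqnorm w.
Proof.
case: z w => [a b] [c d]; rewrite /complex_sqnorm /=.
rewrite -subr_ge0 [leRHS](_ : _ = (a - c) ^+ 2 + (b - d) ^+ 2); last by ring.
by rewrite addr_ge0 ?sqr_ge0.
Qed.

Lemma esumZl_le (T : choiceType) (c : R) (a : T -> R) : 0 <= c ->
  (\esum_(x in [set: T]) (c * a x)%:E <= c%:E * \esum_(x in [set: T]) (a x)%:E)%E.
Proof.
move=> c0; apply: ge_ereal_sup => _ [X [finX XT] <-].
have -> : (\sum_(x \in X) (c * a x)%:E = c%:E * \sum_(x \in X) (a x)%:E)%E.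
  by rewrite !fsbig_finite //= !sumEFin -EFinM mulr_sumr.
by apply: lee_wpmul2l; rewrite ?lee_fin //; apply: ereal_sup_ubound; exists X.
Qed.

Lemma l2_sqnorm_ge0 (f : fctG) : (0 <= l2_sqnorm f)%E.
Proof. by apply: esum_ge0 => x _; rewrite lee_fin complex_sqnorm_ge0. Qed.

Lemma l2_sqnormZ_le (c : R[i]) (f : fctG) :
  (l2_sqnorm (c *: f)%R <= (complex_sqnorm c)%:E * l2_sqnorm f)%E.
Proof.
apply: le_trans (esumZl_le _ (complex_sqnorm_ge0 c)).
by apply: le_esum => x _; rewrite -complex_sqnormM.
Qed.

Lemma l2_sqnormD_le (f g : fctG) :
  (l2_sqnorm (f + g)%R <= 2%:E * l2_sqnorm f + 2%:E * l2_sqnorm g)%E.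
Proof.
have le02 : 0 <= 2 :> R by rewrite ler0n.
apply: le_trans (leeD (esumZl_le _ le02) (esumZl_le _ le02)).
rewrite -esumD; do ?by move=> x _; rewrite lee_fin mulr_ge0 ?complex_sqnorm_ge0.
by apply: le_esum => x _; rewrite -EFinD lee_fin complex_sqnormD_le.
Qed.

Lemma l2_sqnorm_reindex (f : fctG) (e : G -> G) :
  bijective e -> l2_sqnorm (f \o e) = l2_sqnorm f.
Proof.
move=> be; rewrite /l2_sqnorm [RHS](@reindex_esum _ _ _ [set: G] [set: G] e) //.
by rewrite setTT_bijective.
Qed.

Fact square_summable_submod : submod_closed square_summable.
Proof.
split=> [|c f g /asboolP fS /asboolP gS]; apply/asboolP.
  rewrite /l2_sqnorm esum1 ?ltry // => x _.
  by rewrite /complex_sqnorm /= expr0n /= addr0.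
apply: le_lt_trans (l2_sqnormD_le _ _) _.
apply: lte_add_pinfty; rewrite lte_mul_pinfty ?lee_fin ?ler0n //.
apply: le_lt_trans (l2_sqnormZ_le _ _) _.
by rewrite lte_mul_pinfty ?lee_fin ?complex_sqnorm_ge0.
Qed.
HB.instance Definition _ := GRing.isSubmodClosed.Build R[i] fctG
  square_summable square_summable_submod.

Record l2 := L2 { l2_val :> fctG; l2P : square_summable l2_val }.

HB.instance Definition _ := [isSub for l2_val].
HB.instance Definition _ := [Choice of l2 by <:].
HB.instance Definition _ := [SubChoice_isSubLmodule of l2 by <:].

Fact square_summable_reindex (f : l2) (e : G -> G) :
  bijective e -> square_summable (l2_val f \o e).
Proof.
move=> be; rewrite /square_summable l2_sqnorm_reindex //; exact: l2P.
Qed.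

Fact bij_mulgr (g : G) : bijective (fun x : G => (x * g)%g).
Proof. by exists (fun x => (x * g^-1)%g) ; [exact: mulgK|exact: mulgVK]. Qed.

Fact bij_mulVg (g : G) : bijective (fun x : G => (g^-1 * x)%g).
Proof. by exists (fun x => (g * x)%g) ; [exact: mulVKg|exact: mulKg]. Qed.

Definition right_translate (g : G) (f : l2) : l2 :=
  L2 (square_summable_reindex f (bij_mulgr g)).

Definition left_translate (g : G) (f : l2) : l2 :=
  L2 (square_summable_reindex f (bij_mulVg g)).

Fact square_summable_delta :
  square_summable (fun x : G => (x == 1%g)%:R).
Proof.
apply/asboolP; rewrite /l2_sqnorm.
have -> : \esum_(x in [set: G]) (complex_sqnorm ((x == 1%g)%:R : R[i]))%:E
  = \esum_(x in [set 1%g : G]) (1%:E : \bar R).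
  rewrite [RHS]esum_mkcond; apply: eq_esum => x _.
  rewrite /complex_sqnorm; have -> : (x \in [set (1%g : G)]) = (x == 1%g).
    by apply/idP/eqP; rewrite inE.
  by case: (x == _) => /=; rewrite ?expr0n ?expr1n /= addr0.
by rewrite esum_set1 ?ltry.
Qed.

Definition l2_delta1 : l2 := L2 square_summable_delta.

End SquareSummable.

Section GroupVonNeumannAlgebra.
Variables (R : realType) (G : groupType).

Local Notation l2 := (l2 R G).

Definition l2_bounded (T : l2 -> l2) : Prop :=
  exists2 C : R, 0 <= C &
    forall f : l2, (l2_sqnorm (T f) <= C%:E * l2_sqnorm f)%E.

(* N(G): the bounded operators commuting with the right regular
   representation. *)
Definition vN_pred : {pred l2 -> l2} := fun T =>
  `[< [/\ linear T, l2_bounded T &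
       forall g f, T (right_translate g f) = right_translate g (T f)] >].

Lemma l2_sqnorm_fin (f : l2) :
  exists2 r : R, 0 <= r & l2_sqnorm f = r%:E.
Proof.
have := l2_sqnorm_ge0 f; have /asboolP := l2P f.
by case: (l2_sqnorm f) => // r _ r0; exists r; rewrite -?lee_fin.
Qed.

Lemma right_translateB g (f h : l2) :
  right_translate g (f - h) = right_translate g f - right_translate g h.
Proof. exact/val_inj. Qed.

Fact vN_zmod_closed : zmod_closed vN_pred.
Proof.
split=> [|T U /asboolP[Tl [C C0 TC] Tr] /asboolP[Ul [D D0 UD] Ur]].
  apply/asboolP; split=> [a f h||g f].
  - by rewrite /= scaler0 addr0.
  - exists 0 => // f; rewrite mul0e /l2_sqnorm esum1 // => x _.
    by rewrite /complex_sqnorm /= expr0n /= addr0.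
  - exact/val_inj.
apply/asboolP; split=> [a f h||g f].
- rewrite /= !fctE Tl Ul scalerBr opprD; exact: addrACA.
- exists (2 * C + 2 * D); first by rewrite addr_ge0 // mulr_ge0.
  move=> f; apply: le_trans (l2_sqnormD_le _ _) _.
  have -> : l2_sqnorm (- U f : l2) = l2_sqnorm (U f).
    apply: eq_esum => x _; congr (_%:E).
    have -> : l2_val (- U f) x = - l2_val (U f) x by [].
    by case: (l2_val (U f) x) => u v; rewrite /complex_sqnorm /= !sqrrN.
  move: (TC f) (UD f); have [r _ ->] := l2_sqnorm_fin f.
  have [s _ ->] := l2_sqnorm_fin (T f); have [t _ ->] := l2_sqnorm_fin (U f).
  rewrite -!EFinM -!EFinD !lee_fin => sC tD.
  by rewrite [leRHS]mulrDl -!mulrA lerD // ler_wpM2l.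
- by rewrite !fctE Tr Ur right_translateB.
Qed.
HB.instance Definition _ :=
  GRing.isZmodClosed.Build (l2 -> l2) vN_pred vN_zmod_closed.

Record group_vN := GroupVN { vN_op :> l2 -> l2; vN_opP : vN_pred vN_op }.

HB.instance Definition _ := [isSub for vN_op].
HB.instance Definition _ := [Choice of group_vN by <:].
HB.instance Definition _ := [SubChoice_isSubZmodule of group_vN by <:].

Fact vN_pred1 : vN_pred idfun.
Proof.
by apply/asboolP; split => //; exists 1 => // f; rewrite mul1e.
Qed.

Fact vN_predM (T U : group_vN) : vN_pred (T \o U).
Proof.
have /asboolP[Tl [C C0 TC] Tr] := vN_opP T.
have /asboolP[Ul [D D0 UD] Ur] := vN_opP U.
apply/asboolP; split=> [a f h||g f].
- by rewrite /= Ul Tl.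
- exists (C * D); first exact: mulr_ge0.
  move=> f; apply: le_trans (TC _) _.
  by rewrite EFinM -muleA lee_wpmul2l ?lee_fin.
- by rewrite /= Ur Tr.
Qed.

Definition vN_one : group_vN := GroupVN vN_pred1.
Definition vN_mul (T U : group_vN) : group_vN := GroupVN (vN_predM T U).

Fact vN_mulA : associative vN_mul.
Proof. by move=> T U V; exact/val_inj. Qed.

Fact vN_mul1l : left_id vN_one vN_mul.
Proof. by move=> T; exact/val_inj. Qed.

Fact vN_mul1r : right_id vN_one vN_mul.
Proof. by move=> T; exact/val_inj. Qed.

Fact vN_mulDl : left_distributive vN_mul +%R.
Proof. by move=> T U V; exact/val_inj. Qed.

Fact vN_mulDr : right_distributive vN_mul +%R.
Proof.
move=> T U V; apply/val_inj/funext => f /=.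
have /asboolP[Tl _ _] := vN_opP T.
by have := Tl 1 (U f) (V f); rewrite !scale1r.
Qed.

HB.instance Definition _ := GRing.Zmodule_isPzRing.Build group_vN
  vN_mulA vN_mul1l vN_mul1r vN_mulDl vN_mulDr.

Fact vN_pred_left_translate (g : G) : vN_pred (@left_translate R G g).
Proof.
apply/asboolP; split=> [a f h||k f].
- exact/val_inj.
- exists 1 => // f; rewrite mul1e le_eqVlt; apply/orP; left; apply/eqP.
  exact: l2_sqnorm_reindex (bij_mulVg g).
- by apply/val_inj/funext => x /=; rewrite mulgA.
Qed.

Definition vN_translation (g : G) : group_vN := GroupVN (vN_pred_left_translate g).

Definition vN_trace (T : group_vN) : R[i] := T (l2_delta1 R G) 1%g.

End GroupVonNeumannAlgebra.

(* Lueck's dimension: the supremum of the dimensions of the finitely generated projective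
   submodules.  Such a submodule is the isomorphic image, under some [phi], of
   the row image [{x | x *m A = x}] of an idempotent matrix [A], and its
   dimension is the trace of [A], which is a nonnegative real number. *)
Definition vN_dim (R : realType) (G : groupType)
    (M : lmodType (group_vN R G)) : \bar R :=
  ereal_sup [set d | exists n (A : 'M[group_vN R G]_n)
                       (phi : {linear 'rV[group_vN R G]_n -> M}),
    [/\ A *m A = A,
        (forall x, x *m A = x -> phi x = 0 -> x = 0) &
        d = (\sum_i complex.Re (vN_trace (A i i)))%:E]].

Section FirstHomology.
Variables (R : realType) (G : groupType).

Local Notation N := (group_vN R G).

(* A finitely supported [c : G -> N^o] is the 1-chain [\sum_g (c g) [g]] of the
   bar complex [N (x)_(Z G) Bar(G)], where [G] acts on [N] from the right
   through [vN_translation]; similarly for 2-chains.  The differentials are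
     d1 (a [g])   = a g - a,
     d2 (a [g|h]) = a g [h] - a [gh] + a [g]. *)
Definition finitely_supported (T : Type) (c : T -> N^o) : Prop :=
  finite_set [set t | c t <> 0].

Definition bar_single (g : G) (a : N) : G -> N^o :=
  fun x => if x == g then a else 0.

Definition bar_d1 (c : G -> N^o) : N :=
  \sum_(g \in [set: G]) (c g * vN_translation R g - c g).

Definition bar_d2 (c : G * G -> N^o) : G -> N^o :=
  \sum_(p \in [set: G * G])
    (bar_single p.2 (c p * vN_translation R p.1)
     - bar_single (p.1 * p.2)%g (c p) + bar_single p.1 (c p)).

Fact finitely_supported0 (T : Type) : finitely_supported (0 : T -> N^o).
Proof.
by apply: (@sub_finite_set _ _ set0); [move=> t; exact | exact: finite_set0].
Qed.

Fact finitely_supported_lin (T : Type) (a : N) (c c' : T -> N^o) :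
  finitely_supported c -> finitely_supported c' ->
  finitely_supported (a *: c + c').
Proof.
move=> fc fc'; apply: (@sub_finite_set _ _
  ([set t | c t <> 0] `|` [set t | c' t <> 0])); last by rewrite finite_setU.
move=> t /= nz; apply: contrapT => /not_orP[/contrapT c0 /contrapT c'0].
by apply: nz; rewrite !fctE c0 c'0 scaler0 addr0.
Qed.

Fact bar_sum_lin (T : choiceType) (V : lmodType N) (F : T -> N -> V)
    (a : N) (c c' : T -> N^o) :
  (forall t b x y, F t (b * x + y) = b *: F t x + F t y) ->
  finitely_supported c -> finitely_supported c' ->
  \sum_(t \in [set: T]) F t ((a *: c + c') t)
  = a *: (\sum_(t \in [set: T]) F t (c t)) + \sum_(t \in [set: T]) F t (c' t).
Proof.
move=> Flin fc fc'.
have F0 t : F t 0 = 0.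
  by have := Flin t (-1) 0 0; rewrite mulr0 addr0 scaleN1r addNr.
pose A := [set t | c t <> 0] `|` [set t | c' t <> 0].
have fA : finite_set A by rewrite finite_setU.
have out d : (forall t, ~ A t -> d t = 0) ->
    \sum_(t \in [set: T]) F t (d t) = \sum_(t <- fset_set A) F t (d t).
  move=> dA; rewrite -fsbig_finite //; apply/esym/fsbig_widen => // t [_ nA] /=.
  by rewrite dA.
have cA t : ~ A t -> c t = 0 /\ c' t = 0.
  by move=> /not_orP[/contrapT -> /contrapT ->].
rewrite !out; do ?by move=> t /cA[? ?].
  rewrite scaler_sumr -big_split /=; apply: eq_bigr => t _; exact: Flin.
by move=> t /cA[c0 c'0]; rewrite !fctE c0 c'0 scaler0 addr0.
Qed.

Definition bar_cycle : {pred G -> N^o} :=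
  fun c => `[< finitely_supported c /\ bar_d1 c = 0 >].

Fact bar_cycle_submod : submod_closed bar_cycle.
Proof.
split=> [|a c c' /asboolP[fc dc] /asboolP[fc' dc']]; apply/asboolP; split.
- exact: finitely_supported0.
- rewrite /bar_d1 fsbig1 // => g _.
  by rewrite (_ : (0 : G -> N^o) g = 0) // mul0r subrr.
- exact: finitely_supported_lin.
- have E := @bar_sum_lin G N^o (fun g x => x * vN_translation R g - x)
    a c c' _ fc fc'.
  apply: etrans (E _) (etrans (congr2 (fun x y : N^o => a *: x + y) dc dc') _).
    move=> g b x y; rewrite mulrDl opprD scalerBr -mulrA; exact: addrACA.
  by rewrite scaler0 addr0.
Qed.
HB.instance Definition _ := GRing.isSubmodClosed.Build N (G -> N^o)
  bar_cycle bar_cycle_submod.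

Record bar_cycles := BarCycle
  { bar_cycle_val :> G -> N^o; bar_cycleP : bar_cycle bar_cycle_val }.

HB.instance Definition _ := [isSub for bar_cycle_val].
HB.instance Definition _ := [Choice of bar_cycles by <:].
HB.instance Definition _ := [SubChoice_isSubLmodule of bar_cycles by <:].

Definition bar_boundary : {pred bar_cycles} := fun z =>
  `[< exists2 c : G * G -> N^o, finitely_supported c & bar_d2 c = z >].

Fact bar_boundary_submod : submod_closed bar_boundary.
Proof.
split=> [|a z z' /asboolP[c fc dc] /asboolP[c' fc' dc']]; apply/asboolP.
  exists 0; first exact: finitely_supported0.
  rewrite /bar_d2 fsbig1 // => p _; apply/funext => x.
  by rewrite !fctE /bar_single mul0r !if_same subrr addr0.
exists (a *: c + c'); first exact: finitely_supported_lin.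
have /= := @bar_sum_lin (G * G)%type (G -> N^o)
  (fun p x => bar_single p.2 (x * vN_translation R p.1)
     - bar_single (p.1 * p.2)%g x + bar_single p.1 x) a c c' _ fc fc'.
rewrite -/(bar_d2 c) -/(bar_d2 c') dc dc'; apply.
move=> p b x y; apply/funext => u; rewrite !fctE /bar_single.
have E (t : bool) (v w : N) :
    (if t then b * v + w else 0) = b * (if t then v else 0) + (if t then w else 0).
  by case: t; rewrite ?mulr0 ?addr0.
have L (p1 p2 p3 q1 q2 q3 : N) : (b * p1 + q1) - (b * p2 + q2) + (b * p3 + q3)
    = b * (p1 - p2 + p3) + (q1 - q2 + q3).
  by rewrite mulrDr mulrBr opprD (addrACA (b * p1) q1) (addrACA (b * p1 - b * p2)).
rewrite mulrDl -mulrA !E; exact: L.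
Qed.

Definition vN_H1 : lmodType N := lmod_quot bar_boundary_submod.

End FirstHomology.

(* The dimension of [H_1(G; N(G))] (Lueck); no finiteness condition on [G] is
   involved. *)
Definition l2_betti1 (R : realType) (G : groupType) : \bar R :=
  vN_dim (vN_H1 R G).

Section ElementaryGroup.
Variables (n : nat) (A : nzRingType).

Definition elementary_mx (i j : 'I_n) (r : A) : 'M[A]_n :=
  1%:M + r *: delta_mx i j.

Inductive in_EL : 'M[A]_n -> Prop :=
| in_EL_elementary (i j : 'I_n) (r : A) : i != j -> in_EL (elementary_mx i j r)
| in_EL_one : in_EL 1%:M
| in_EL_mul (M N : 'M[A]_n) : in_EL M -> in_EL N -> in_EL (M *m N)
| in_EL_inv (M N : 'M[A]_n) :
    in_EL M -> M *m N = 1%:M -> N *m M = 1%:M -> in_EL N.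

Lemma elementary_mxN i j r : i != j ->
  elementary_mx i j r *m elementary_mx i j (- r) = 1%:M.
Proof.
move=> ij; rewrite /elementary_mx scaleNr.
rewrite mulmxDl mul1mx mulmxDr mulmx1 mulmxN.
suff -> : (r *: delta_mx i j) *m (r *: delta_mx i j) = 0 :> 'M[A]_n.
  by rewrite subr0 subrK.
apply/matrixP => k l; rewrite !mxE big1 // => m _; rewrite !mxE.
have [->|_] := eqVneq m j; last by rewrite andbF mulr0 mul0r.
by rewrite (eq_sym j) (negbTE ij) /= mulr0 mulr0.
Qed.

Lemma in_EL_inverse (M : 'M[A]_n) : in_EL M ->
  exists N : 'M[A]_n, [/\ in_EL N, M *m N = 1%:M & N *m M = 1%:M].
Proof.
elim=> [i j r ij||M1 M2 _ [N1 [E1 l1 r1]] _ [N2 [E2 l2 r2]]|M1 N1 E1 _ l1 r1].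
- exists (elementary_mx i j (- r)); split.
  + exact: in_EL_elementary.
  + exact: elementary_mxN.
  + by rewrite -[X in _ *m elementary_mx i j X]opprK elementary_mxN.
- by exists 1%:M; split; rewrite ?mulmx1 //; exact: in_EL_one.
- exists (N2 *m N1); split; first exact: in_EL_mul.
  + by rewrite mulmxA -(mulmxA M1) l2 mulmx1.
  + by rewrite mulmxA -(mulmxA N2) r1 mulmx1.
- by exists M1.
Qed.

Definition EL_pred : {pred 'M[A]_n} := fun M => `[< in_EL M >].

Record EL := ELMatrix { EL_val :> 'M[A]_n; EL_valP : EL_pred EL_val }.

HB.instance Definition _ := [isSub for EL_val].
HB.instance Definition _ := [Choice of EL by <:].

Fact EL_pred1 : EL_pred 1%:M.
Proof. exact/asboolP/in_EL_one. Qed.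

Fact EL_predM (M N : EL) : EL_pred (M *m N).
Proof.
have /asboolP ? := EL_valP M; have /asboolP ? := EL_valP N.
exact/asboolP/in_EL_mul.
Qed.

Definition EL_one : EL := ELMatrix EL_pred1.
Definition EL_mul (M N : EL) : EL := ELMatrix (EL_predM M N).

Fact EL_has_inv (M : EL) : exists N : EL, EL_mul M N = EL_one /\ EL_mul N M = EL_one.
Proof.
have /asboolP /in_EL_inverse [N [NE l r]] := EL_valP M.
by exists (ELMatrix (asboolT NE)); split; exact/val_inj.
Qed.

Definition EL_inv (M : EL) : EL := projT1 (cid (EL_has_inv M)).

Fact EL_mulA : associative EL_mul.
Proof. by move=> M N P; apply/val_inj; exact: mulmxA. Qed.

Fact EL_mul1l : left_id EL_one EL_mul.
Proof. by move=> M; apply/val_inj; exact: mul1mx. Qed.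

Fact EL_mul1r : right_id EL_one EL_mul.
Proof. by move=> M; apply/val_inj; exact: mulmx1. Qed.

Fact EL_mulVl : left_inverse EL_one EL_inv EL_mul.
Proof. by move=> M; rewrite /EL_inv; case: cid => N []. Qed.

Fact EL_mulVr : right_inverse EL_one EL_inv EL_mul.
Proof. by move=> M; rewrite /EL_inv; case: cid => N []. Qed.

HB.instance Definition _ :=
  isGroup.Build EL EL_mulA EL_mul1l EL_mul1r EL_mulVl EL_mulVr.

End ElementaryGroup.

(* Main.v *)
Require Import Defs.
From mathcomp Require Import all_boot all_order all_algebra finmap complex.
From mathcomp Require Import all_classical all_reals all_analysis.
From mathcomp Require Import ring lra.

(** Write [N] for the group von Neumann algebra and [L g] for the translation by
    [g].  The theorem holds because [H_1(G; N)] is a torsion module over [N], in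
    the following quantitative sense: for every class [x] and every [d > 0] some
    [r] in [N] kills [x] and is [d]-close to [1] in the squared 2-norm
    [n2 T = |T delta|^2].  A projective module [im A] embedded in such a module
    has [r A = 0] for [r] arbitrarily close to [1], so [A = 0]
    ([approx_annihilator], [l2_betti1_eq0]).

    Torsion elements form a submodule.  This rests on the finiteness of [N], that
    is on its trace, through an approximate Ore condition ([ore_approx]): given [a] and [r], there are [s] and [b] with [s a = b r] and
    [s] almost as close to [1] as [r] is.  To find them, let [K] be the
    projection of [l2 + l2] onto the kernel of the adjoint of the column
    [V = (a; r)].  Its entries [s, q] in the first row satisfy
    [s a + q r = 0], and [K] has trace at least [2 - 1 = 1], because
    [(1 - V V^* )^k], which converges strongly to [K] along even [k], differs in
    trace by exactly [1] from [(1 - V^* V)^k] ([kernel_projection]).  The two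
    diagonal corners [s] and [y] of [K] are tied by a comparison of moments
    ([corner_moments]): [1 - s] has small powers as soon as [y] has.  Since the
    limit of the powers of [y] is carried by the kernel of [r^*], these powers
    are small when [r] is close to [1] ([corner_powers_small]).  Finally
    [1 - (1 - s)^k] is a left multiple of [s] close to [1].

    On the group side, let [e] have infinite order and work with bar 1-chains
    modulo boundaries and multiples of [[e]].  The relation
    [[g h] = g [h] + [g]] shows that the [g] for which [[g]] is torsion form a
    subgroup.  If such a [g] has infinite order and commutes with [h], then
    [(g - 1) [h] = (h - 1) [g]] is torsion; as [N (g - 1)] comes arbitrarily
    close to [1], by averaging over powers of [g], the chain [[h]] is torsion too
    ([tor_commute]).  In [EL_n] with [n >= 3] and characteristic [0] the
    elementary matrices [E_ij(1)] have infinite order, and one reaches every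
    [E_kl(s)] from [E_01(1)] through commuting pairs ([EL_commuting_chain]).
    Hence every 1-chain is torsion modulo [[e]] and the boundaries.  For a cycle
    the coefficient [b] of [[e]] satisfies [b (e - 1) = 0], so [b = 0], and the
    cycle is torsion modulo boundaries alone ([torsion_cycle]). *)

Set Implicit Arguments.
Unset Strict Implicit.
Unset Printing Implicit Defensive.
Import Order.TTheory GRing.Theory Num.Theory numFieldNormedType.Exports.

Local Open Scope classical_set_scope.
Local Open Scope ring_scope.

(* Keeps [l2] and [group_vN] elements folded: unfolding their algebraic
   operations makes unification very expensive. *)
Arguments l2_val : simpl never.
Arguments vN_op : simpl never.

(** * The real inner product on l2 *)

Section InnerProduct.
Variables (R : realType) (G : groupType).
Local Notation H := (l2 R G).
Local Notation csq := (@complex_sqnorm R).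
Implicit Types (f g h : H) (x : G).

Definition sqn f : R := fine (l2_sqnorm f).

Lemma sqnE f : l2_sqnorm f = (sqn f)%:E.
Proof. by rewrite /sqn; have [r _ ->] := l2_sqnorm_fin f. Qed.

Lemma sqn_ge0 f : 0 <= sqn f.
Proof. by rewrite -lee_fin -sqnE l2_sqnorm_ge0. Qed.

Lemma esumZl (T : choiceType) (c : R) (a : T -> R) : 0 <= c ->
  (\esum_(u in [set: T]) (c * a u)%:E = c%:E * \esum_(u in [set: T]) (a u)%:E)%E.
Proof.
rewrite le_eqVlt => /predU1P[<-|c0].
  by rewrite mul0e esum1 // => x _; rewrite mul0r.
apply/eqP; rewrite eq_le (esumZl_le _ (ltW c0)) /=.
have : (\esum_(u in [set: T]) (c^-1 * (c * a u))%:E <=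
   (c^-1)%:E * \esum_(u in [set: T]) (c * a u)%:E)%E.
  by apply: esumZl_le; rewrite invr_ge0 ltW.
rewrite (@eq_esum _ _ _ _ (fun u => (a u)%:E)); last first.
  by move=> u _; rewrite mulKf ?gt_eqF.
move=> h; have c0' : (0 <= c%:E)%E by rewrite lee_fin ltW.
have := lee_wpmul2l c0' h.
by rewrite muleA -EFinM divff ?gt_eqF // mul1e.
Qed.

Lemma sqn_sum_esum (s : seq (R * H)) : all (fun p => 0 <= p.1) s ->
  (\sum_(p <- s) p.1 * sqn p.2)%:E =
  \esum_(x in [set: G]) (\sum_(p <- s) p.1 * csq (p.2 x))%:E.
Proof.
elim: s => [|[c f] s IH] /=.
  by move=> _; rewrite big_nil esum1 // => x _; rewrite big_nil.
move=> /andP[c0 s0]; rewrite big_cons EFinD IH // EFinM -sqnE /=.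
rewrite -esumZl // -esumD; first by apply: eq_esum => x _; rewrite big_cons EFinD.
  by move=> x _; rewrite lee_fin mulr_ge0 ?complex_sqnorm_ge0.
move=> x _; rewrite lee_fin big_seq sumr_ge0 // => p ps.
by rewrite mulr_ge0 ?complex_sqnorm_ge0 // (allP s0).
Qed.

(** An identity between squared moduli that holds pointwise integrates to squared
    norms.  Every rule for the inner product is proved from such an identity
    between series of nonnegative terms, so that no signed series is summed. *)
Lemma sqn_pointwise (s t : seq (R * H)) :
  all (fun p => 0 <= p.1) s -> all (fun p => 0 <= p.1) t ->
  (forall x, \sum_(p <- s) p.1 * csq (p.2 x) = \sum_(p <- t) p.1 * csq (p.2 x)) ->
  \sum_(p <- s) p.1 * sqn p.2 = \sum_(p <- t) p.1 * sqn p.2.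
Proof.
move=> s0 t0 st; apply: EFin_inj; rewrite !sqn_sum_esum //.
by apply: eq_esum => x _; rewrite st.
Qed.

(** The real part of the Hermitian product, by polarization.  A real-valued form
    is enough: it has the same adjoints and the same orthogonality to complex
    subspaces. *)
Definition ip f g : R := (sqn (f + g) - sqn (f - g)) / 4.

End InnerProduct.

(** Norms and inner products are generalized first, because [lra] compares its
    atoms up to conversion and would unfold the vectors inside them. *)
Ltac ip_lra := repeat (match goal with
  | |- context [sqn ?f] => generalize (sqn f)
  | |- context [ip ?f ?g] => generalize (ip f g) end; intro); lra.

Section InnerProductTheory.
Variables (R : realType) (G : groupType).
Local Notation H := (l2 R G).
Local Notation csq := (@complex_sqnorm R).
Implicit Types (f g h : H) (x : G).

Lemma l2D f g x : (f + g) x = f x + g x. Proof. by []. Qed.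
Lemma l2N f x : (- f) x = - f x. Proof. by []. Qed.
Lemma l2Z c f x : (c *: f) x = c * f x. Proof. by []. Qed.

Lemma sqn_pointwise3 (a b c a' b' c' : R) f g h f' g' h' :
  [&& 0 <= a, 0 <= b, 0 <= c, 0 <= a', 0 <= b' & 0 <= c'] ->
  (forall x, a * csq (f x) + b * csq (g x) + c * csq (h x) =
             a' * csq (f' x) + b' * csq (g' x) + c' * csq (h' x)) ->
  a * sqn f + b * sqn g + c * sqn h = a' * sqn f' + b' * sqn g' + c' * sqn h'.
Proof.
move=> /and5P[a0 b0 c0 a0' /andP[b0' c0']] E.
have := @sqn_pointwise R G [:: (a, f); (b, g); (c, h)] [:: (a', f'); (b', g'); (c', h')].
rewrite /= a0 b0 c0 a0' b0' c0' !big_cons !big_nil /= => /(_ isT isT).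
have L (u v w : R) : u + (v + (w + 0)) = u + v + w by rewrite addr0 addrA.
rewrite !L; apply => x; rewrite !big_cons !big_nil /= !L; exact: E.
Qed.

Lemma sqnZ c f : sqn (c *: f) = csq c * sqn f.
Proof.
have := @sqn_pointwise3 1 0 0 (csq c) 0 0 (c *: f) 0 0 f 0 0.
rewrite !mul0r !addr0 mul1r; apply=> [|x].
  by rewrite ler01 lexx complex_sqnorm_ge0.
by rewrite !mul0r !addr0 mul1r l2Z complex_sqnormM.
Qed.

Lemma sqn0 : sqn (0 : H) = 0.
Proof. by have := sqnZ 0 0; rewrite scale0r /complex_sqnorm /= expr0n /= addr0 mul0r. Qed.

Lemma sqnN f : sqn (- f) = sqn f.
Proof.
by rewrite -scaleN1r sqnZ /complex_sqnorm /= oppr0 sqrrN expr1n expr0n addr0 mul1r.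
Qed.

Lemma ipC f g : ip f g = ip g f.
Proof. by rewrite /ip (addrC f) -(opprB g f) sqnN. Qed.

Lemma ipDl f g h : ip (f + g) h = ip f h + ip g h.
Proof.
have := @sqn_pointwise3 1 1 1 1 1 1
  (f + g + h) (f - h) (g - h) (f + g - h) (f + h) (g + h).
have A (p q r s t u : R) : 1 * p + 1 * q + 1 * r = 1 * s + 1 * t + 1 * u ->
    (p - s) / 4 = (t - q) / 4 + (u - r) / 4 by lra.
rewrite ler01 => /(_ isT) E; apply/A/E => x; rewrite !l2D !l2N.
case: (f x) (g x) (h x) => [a b] [c d] [u v]; rewrite /complex_sqnorm /=; ring.
Qed.

Lemma ip0l f : ip 0 f = 0.
Proof. by have := ipDl 0 0 f; rewrite addr0; ip_lra. Qed.

Lemma ipNl f g : ip (- f) g = - ip f g.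
Proof. by have := ipDl f (- f) g; rewrite subrr ip0l; ip_lra. Qed.

Lemma ipBl f g h : ip (f - g) h = ip f h - ip g h.
Proof. by rewrite ipDl ipNl. Qed.

Lemma ipDr f g h : ip h (f + g) = ip h f + ip h g.
Proof. by rewrite ipC ipDl !(ipC h). Qed.

Lemma ipNr f g : ip f (- g) = - ip f g.
Proof. by rewrite ipC ipNl ipC. Qed.

Lemma ipBr f g h : ip h (f - g) = ip h f - ip h g.
Proof. by rewrite ipDr ipNr. Qed.

Lemma ip0r f : ip f 0 = 0.
Proof. by rewrite ipC ip0l. Qed.

Lemma ip_sumr (I : Type) (r : seq I) (P : pred I) (F : I -> H) f :
  ip f (\sum_(i <- r | P i) F i) = \sum_(i <- r | P i) ip f (F i).
Proof. by elim/big_rec2: _ => [|i y1 y2 _ <-]; rewrite ?ip0r ?ipDr. Qed.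

Lemma ip_suml (I : Type) (r : seq I) (P : pred I) (F : I -> H) f :
  ip (\sum_(i <- r | P i) F i) f = \sum_(i <- r | P i) ip (F i) f.
Proof. by rewrite ipC ip_sumr; apply: eq_bigr => i _; rewrite ipC. Qed.

Lemma ip_sqn f : ip f f = sqn f.
Proof.
rewrite /ip subrr sqn0 subr0 -mulr2n -scaler_nat sqnZ.
have -> : csq 2%:R = 4 by rewrite mulr2n /complex_sqnorm /=; ring.
by field.
Qed.

Lemma sqnD f g : sqn (f + g) = sqn f + 2 * ip f g + sqn g.
Proof. rewrite -!ip_sqn ipDl !ipDr (ipC g f); ip_lra. Qed.

Lemma sqnB f g : sqn (f - g) = sqn f - 2 * ip f g + sqn g.
Proof. by rewrite sqnD sqnN ipNr mulrN. Qed.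

Lemma sqnD_le f g : sqn (f + g) <= 2 * sqn f + 2 * sqn g.
Proof. have := sqn_ge0 (f - g); rewrite sqnB sqnD; ip_lra. Qed.

Lemma ipZ c f g : ip (c *: f) g = ip f ((c^*)%C *: g).
Proof.
have := @sqn_pointwise3 1 1 0 1 1 0
  (c *: f + g) (f - (c^*)%C *: g) 0 (c *: f - g) (f + (c^*)%C *: g) 0.
have A (p q r s t : R) : 1 * p + 1 * q + 0 * r = 1 * s + 1 * t + 0 * r ->
    (p - s) / 4 = (t - q) / 4 by lra.
rewrite ler01 lexx => /(_ isT) E; apply/A/E => x; rewrite !l2D !l2N !l2Z {E}.
case: c (f x) (g x) => [a b] [p q] [u v]; rewrite /complex_sqnorm /=; ring.
Qed.

Lemma ipZr (c : R) f g : ip f (Complex c 0 *: g) = c * ip f g.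
Proof.
have S h k (a : R) : 0 <= a -> ip h (Complex a 0 *: k) = a * ip h k.
  move=> a0; have := @sqn_pointwise3 1 a 0 1 a 0
    (h + Complex a 0 *: k) (h - k) 0 (h - Complex a 0 *: k) (h + k) 0.
  have A (p q r s t : R) : 1 * p + a * q + 0 * r = 1 * s + a * t + 0 * r ->
    (p - s) / 4 = a * ((t - q) / 4) by lra.
  rewrite ler01 lexx a0 => /(_ isT) E; apply/A/E => x; rewrite !l2D !l2N !l2Z {E}.
  case: (h x) (k x) => [p q] [u v]; rewrite /complex_sqnorm /=; ring.
have [c0|/ltW c0] := lerP 0 c; first exact: S.
have -> : Complex c 0 = - Complex (- c) 0 by rewrite /GRing.opp /= opprK oppr0.
by rewrite scaleNr ipNr S ?oppr_ge0 // mulNr opprK.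
Qed.

Lemma ip_CS f g : ip f g ^+ 2 <= sqn f * sqn g.
Proof.
have K (t : R) : 0 <= sqn f + 2 * t * ip f g + t ^+ 2 * sqn g.
  have := sqn_ge0 (f + Complex t 0 *: g).
  by rewrite sqnD ipZr sqnZ /complex_sqnorm /= expr0n /= addr0 mulrA.
move: (sqn f) (sqn g) (ip f g) (sqn_ge0 f) (sqn_ge0 g) K => p q r p0 q0 K.
(* the discriminant of the quadratic polynomial K; if q = 0 the polynomial is affine,
   and its value at -(p + 1) / (2 r) would be -1 *)
have [q00|q1] := eqVneq q 0.
  have := K (- (p + 1) / 2 / r); rewrite q00 !mulr0 addr0.
  have [->|n0] := eqVneq r 0; first by rewrite expr0n lexx.
  by have -> : 2 * (- (p + 1) / 2 / r) * r = - (p + 1); [field | lra].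
have q2 : 0 < q by rewrite lt_def q1.
have := K (- r / q).
have -> : p + 2 * (- r / q) * r + (- r / q) ^+ 2 * q = (p * q - r ^+ 2) / q by field.
by rewrite pmulr_lge0 ?invr_gt0 // subr_ge0.
Qed.

Lemma ip_le f g (a b : R) : 0 < a -> sqn f <= a -> sqn g <= b ->
  ip f g ^+ 2 <= a * b.
Proof.
move=> a0 fa gb; apply: le_trans (ip_CS _ _) _.
by apply: ler_pM => //; exact: sqn_ge0.
Qed.

End InnerProductTheory.

(** * Finitely supported vectors *)

Section FiniteSupport.
Variables (R : realType) (G : groupType).
Local Notation H := (l2 R G).
Local Notation csq := (@complex_sqnorm R).
Implicit Types (f g h : H) (k x y : G).

Lemma sum_csq_le (F : {fset G}) f : \sum_(x <- F) csq (f x) <= sqn f.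
Proof.
rewrite -lee_fin -sqnE -sumEFin; apply: ereal_sup_ubound.
exists [set` F]; first by split.
by rewrite fsbig_finite //= set_fsetK.
Qed.

Lemma csq_le f x : csq (f x) <= sqn f.
Proof. by have := sum_csq_le [fset x]%fset f; rewrite big_seq_fset1. Qed.

(** Square-summability can be tested on finite sets: this is how the adjoint and
    the limit of a Cauchy sequence are shown to lie in [l2]. *)
Lemma l2_of_bound (h : G -> R[i]) (M : R) :
  (forall F : {fset G}, \sum_(x <- F) csq (h x) <= M) ->
  exists2 f : H, (forall x, f x = h x) & sqn f <= M.
Proof.
move=> hM.
have M1 : (\esum_(x in [set: G]) (csq (h x))%:E <= M%:E)%E.
  apply: ge_ereal_sup => _ [X [finX _] <-].
  by rewrite fsbig_finite //= sumEFin lee_fin.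
have hS : square_summable (h : G -> (R[i])^o).
  by apply/asboolP; apply: le_lt_trans M1 (ltry _).
by exists (L2 hS) => //; rewrite -lee_fin -sqnE.
Qed.

Lemma l2_eqP f g : (forall x, f x = g x) -> f = g.
Proof. by move=> fg; apply/val_inj/funext. Qed.

Lemma sqn_eq0 f : sqn f <= 0 -> f = 0.
Proof.
move=> f0; apply: l2_eqP => x; have := le_trans (csq_le f x) f0.
case: (f x) => a b; rewrite /complex_sqnorm /= => ab0.
have := sqr_ge0 a; have := sqr_ge0 b => b2 a2.
have /eqP : a ^+ 2 = 0 by lra.
have /eqP : b ^+ 2 = 0 by lra.
by rewrite !sqrf_eq0 => /eqP -> /eqP ->.
Qed.

Lemma ip_eq0 f : (forall h, ip f h = 0) -> f = 0.
Proof. by move=> f0; apply: sqn_eq0; rewrite -ip_sqn f0. Qed.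

Lemma sqn_right_translate k f : sqn (right_translate k f) = sqn f.
Proof.
by rewrite /sqn; congr fine; exact: l2_sqnorm_reindex (bij_mulgr k).
Qed.

(** The basis vector at [x]. *)
Definition pt x : H := right_translate x^-1%g (l2_delta1 R G).

Lemma ptE x y : pt x y = (y == x)%:R.
Proof.
rewrite /pt /right_translate /l2_delta1 /l2_val /=.
by rewrite -(can_eq (mulgK x)) mulgVK mul1g.
Qed.

Lemma sqn_pt x : sqn (pt x) = 1.
Proof.
rewrite /pt sqn_right_translate; apply: EFin_inj; rewrite -sqnE /l2_sqnorm.
rewrite (@eq_esum _ _ _ _ (fun y => if y \in [set 1%g : G] then 1%E else 0%E)).
  by rewrite -esum_mkcond esum_set1.
move=> y _; have -> : (y \in [set (1%g : G)]) = (y == 1%g).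
  by apply/idP/eqP; rewrite inE.
rewrite /l2_val /complex_sqnorm /=.
by case: (y == _) => /=; rewrite ?expr0n ?expr1n /= addr0.
Qed.

Lemma right_translateE k f x : right_translate k f x = f (x * k)%g.
Proof. by []. Qed.

Definition cdot (z w : R[i]) : R :=
  complex.Re z * complex.Re w + complex.Im z * complex.Im w.

Lemma cdotzz z : cdot z z = csq z.
Proof. by rewrite /cdot /complex_sqnorm !expr2. Qed.

Lemma ip_pt f x z : ip f (z *: pt x) = cdot (f x) z.
Proof.
have := @sqn_pointwise3 R G 1 (csq (f x - z)) 0 1 (csq (f x + z)) 0
  (f + z *: pt x) (pt x) 0 (f - z *: pt x) (pt x) 0.
rewrite ler01 lexx !complex_sqnorm_ge0 => /(_ isT) E.
(* f + z pt x and f - z pt x differ only at x; multiples of |pt x|^2 = 1 absorb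
   the difference *)
have A (p q r s t : R) : 1 * p + r * 1 + 0 * t = 1 * q + s * 1 + 0 * t ->
  p - q = s - r by lra.
rewrite sqn_pt in E; rewrite /ip (A _ _ _ _ _ (E _)) {E} => [|y].
  by rewrite /cdot /complex_sqnorm; case: (f x) z => a b [c d] /=; field.
rewrite !l2D !l2N !l2Z !ptE; have [->|_] := eqVneq y x.
  by rewrite mulr1 /complex_sqnorm; case: (f x) z => a b [c d] /=; ring.
by rewrite mulr0 subr0 addr0 /complex_sqnorm /= !expr0n /=; ring.
Qed.

Lemma l2_sum (I : Type) (r : seq I) (F : I -> H) x :
  (\sum_(i <- r) F i) x = \sum_(i <- r) F i x.
Proof. by elim/big_rec2: _ => // i u v _ <-. Qed.

Definition trunc (F : {fset G}) (h : G -> R[i]) : H := \sum_(x <- F) h x *: pt x.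

Lemma truncE F (h : G -> R[i]) x : x \in F -> trunc F h x = h x.
Proof.
move=> xF; rewrite /trunc l2_sum (big_fsetD1 x) //= l2Z ptE eqxx mulr1.
rewrite big_seq_cond big1 ?addr0 // => y /andP[]; rewrite !inE => /andP[yx _] _.
by rewrite l2Z ptE eq_sym (negbTE yx) mulr0.
Qed.

Lemma ip_trunc f F (h : G -> R[i]) : ip f (trunc F h) = \sum_(x <- F) cdot (f x) (h x).
Proof. by rewrite ip_sumr; apply: eq_bigr => x _; rewrite ip_pt. Qed.

Lemma sqn_trunc F (h : G -> R[i]) : sqn (trunc F h) = \sum_(x <- F) csq (h x).
Proof.
rewrite -ip_sqn ip_trunc big_seq [RHS]big_seq; apply: eq_bigr => x xF.
by rewrite truncE // cdotzz.
Qed.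

Lemma sqn_subtrunc f F : sqn (f - trunc F f) = sqn f - \sum_(x <- F) csq (f x).
Proof.
rewrite sqnB sqn_trunc ip_trunc (eq_bigr (fun x => csq (f x))); last first.
  by move=> x _; rewrite cdotzz.
move: (\sum_(x <- F) csq (f x)) => S; ip_lra.
Qed.

Lemma sqn_approx f (e : R) : 0 < e -> exists F : {fset G}, sqn (f - trunc F f) < e.
Proof.
move=> e0; apply: contrapT => /forallNP nF.
have [F|g gf] := @l2_of_bound f (sqn f - e).
  by have /negP := nF F; rewrite -leNgt sqn_subtrunc; lra.
by rewrite (l2_eqP gf) => ?; lra.
Qed.

Lemma le0_of_le_eps (a M : R) : (forall e, 0 < e -> a <= M * e) -> a <= 0.
Proof.
move=> aM; rewrite leNgt; apply/negP => a0.
have [M0|M0] := lerP M 0; first by have := aM 1 ltr01; lra.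
have /aM : 0 < a / (2 * M) by rewrite divr_gt0 ?mulr_gt0.
have -> : M * (a / (2 * M)) = a / 2 by field; rewrite gt_eqF.
lra.
Qed.

(** Finitely supported vectors are dense, so they determine a bounded functional. *)
Lemma ip_trunc_ext (T : H -> H) (C : R) f g : 0 <= C ->
  (forall u v, T (u - v) = T u - T v) -> (forall u, sqn (T u) <= C * sqn u) ->
  (forall F (h : G -> R[i]), ip g (trunc F h) = ip f (T (trunc F h))) ->
  forall h, ip g h = ip f (T h).
Proof.
move=> C0 TB TC E h; apply/eqP; rewrite -subr_eq0 -sqrf_eq0 eq_le sqr_ge0 andbT.
apply: (@le0_of_le_eps _ (2 * sqn g + 2 * sqn f * C)) => e /(sqn_approx h) [F].
set d := _ - _ => de.
have -> : ip g h - ip f (T h) = ip g d - ip f (T d).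
  by rewrite TB !ipBr E; ip_lra.
have := ip_CS g d; have := ip_CS f (T d); have := TC d.
move: (ip f _) (ip g _) (sqn_ge0 f) (sqn_ge0 g) (sqn_ge0 d) de.
move: (sqn f) (sqn g) (sqn d) (sqn (T d)) => p q r s x y p0 q0 r0 re sC xp yq.
have := sqr_ge0 (x + y); have : p * s <= p * (C * e).
  by rewrite ler_wpM2l // (le_trans sC) // ler_wpM2l // ltW.
have : q * r <= q * e by rewrite ler_wpM2l // ltW.
by nra.
Qed.

End FiniteSupport.

(** * Strong convergence and completeness *)

Section Convergence.
Variables (R : realType) (G : groupType).
Local Notation H := (l2 R G).
Local Notation csq := (@complex_sqnorm R).
Implicit Types (f g h v w : H) (u : nat -> H).

Definition cvg2 u v := sqn (u k - v) @[k --> \oo] --> (0 : R).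

Lemma cvg2_bound u v (r : nat -> R) :
  (forall k, sqn (u k - v) <= r k) -> r @ \oo --> (0 : R) -> cvg2 u v.
Proof.
move=> ur r0; apply: (squeeze_cvgr _ (cvg_cst (0 : R)) r0).
by apply: nearW => k; rewrite sqn_ge0 ur.
Qed.

Lemma cvg2_unique u v w : cvg2 u v -> cvg2 u w -> v = w.
Proof.
move=> uv uw; apply/eqP; rewrite -subr_eq0; apply/eqP/sqn_eq0.
have K : (2 * sqn (u k - v) + 2 * sqn (u k - w)) @[k --> \oo] --> (2 * 0 + 2 * 0 : R).
  by apply: cvgD; apply: cvgMl_tmp.
rewrite mulr0 addr0 in K; apply: (cvgr_to_ge K); apply: nearW => k.
have -> : v - w = - (u k - v) + (u k - w) by rewrite opprB addrA subrK.
by apply: le_trans (sqnD_le _ _) _; rewrite sqnN.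
Qed.

Lemma cvg2_cst v : cvg2 (fun=> v) v.
Proof. by apply: (@cvg2_bound _ _ (fun=> 0)) => [k|]; [rewrite subrr sqn0 | exact: cvg_cst]. Qed.

Lemma cvg2D u v u' v' : cvg2 u v -> cvg2 u' v' -> cvg2 (fun k => u k + u' k) (v + v').
Proof.
move=> uv uv'.
have K : (2 * sqn (u k - v) + 2 * sqn (u' k - v')) @[k --> \oo] --> (2 * 0 + 2 * 0 : R).
  by apply: cvgD; apply: cvgMl_tmp.
rewrite mulr0 addr0 in K; apply: cvg2_bound K => k.
by rewrite opprD addrACA sqnD_le.
Qed.

Lemma cvg2_op (T : H -> H) (C : R) u v : (forall f g, T (f - g) = T f - T g) ->
  (forall f, sqn (T f) <= C * sqn f) -> cvg2 u v -> cvg2 (T \o u) (T v).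
Proof.
move=> TB TC uv; apply: (@cvg2_bound _ _ (fun k => C * sqn (u k - v))) => [k|].
  by rewrite -TB.
by rewrite -[X in _ --> X](mulr0 C); apply: cvgMl_tmp.
Qed.

Lemma cvg2_ip u v w : cvg2 u v -> ip (u k) w @[k --> \oo] --> ip v w.
Proof.
move=> uv; apply/cvgrPdist_le => e e0.
have w1 : 0 < sqn w + 1 by have := sqn_ge0 w; lra.
have d0 : 0 < e ^+ 2 / (sqn w + 1) by rewrite divr_gt0 // exprn_gt0.
move/cvgrPdist_le : uv => /(_ _ d0); apply: filterS => k.
rewrite sub0r normrN ger0_norm ?sqn_ge0 // => uk.
rewrite -ler_sqr ?nnegrE ?normr_ge0 ?(ltW e0) // distrC -ipBl real_normK ?num_real //.
apply: le_trans (ip_CS _ _) _; rewrite ler_pdivlMr // in uk.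
by apply: le_trans uk; rewrite ler_wpM2l ?sqn_ge0 // lerDl.
Qed.

Lemma cvg2_shift u v m : cvg2 u v -> cvg2 (fun k => u (k + m)%N) v.
Proof.
move=> uv.
have := @cvg_comp _ _ _ (fun k => (k + m)%N) (fun k => sqn (u k - v)) \oo \oo (nbhs (0 : R)).
apply; first exact: cvg_addnr.
exact uv.
Qed.

Lemma real_cauchy (a : nat -> R) :
  (forall e : R, 0 < e -> exists N, forall k l, (N <= k)%N -> (N <= l)%N ->
    (a k - a l) ^+ 2 <= e) -> exists l : R, a @ \oo --> l.
Proof.
move=> aC; apply/cvg_ex/cauchy_cvgP/cauchyP => e e0.
have [|N NC] := aC ((e / 2) ^+ 2); first by rewrite exprn_gt0 // divr_gt0.
exists (a N); exists N => // k /= Nk; rewrite /ball /= .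
have := NC _ _ (leqnn N) Nk; rewrite -[X in X <= _]real_normK ?num_real //.
rewrite ler_sqr ?nnegrE ?normr_ge0 ?divr_ge0 ?(ltW e0) // => h.
by apply: le_lt_trans h _; lra.
Qed.

(** The limit is taken coordinatewise; finite partial sums of the distances pass to
    the limit, which gives both square-summability and convergence in norm. *)
Lemma l2_complete u :
  (forall e : R, 0 < e -> exists N, forall k l, (N <= k)%N -> (N <= l)%N ->
    sqn (u k - u l) <= e) -> exists v, cvg2 u v.
Proof.
move=> uC.
have reC x : exists l : R, complex.Re (u k x) @[k --> \oo] --> l.
  apply: real_cauchy => e /uC [N NC]; exists N => k l Nk Nl.
  apply: le_trans (NC _ _ Nk Nl); apply: le_trans (csq_le _ x).
  rewrite l2D l2N; case: (u k x) (u l x) => a b [c d].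
  by rewrite /complex_sqnorm /= lerDl sqr_ge0.
have imC x : exists l : R, complex.Im (u k x) @[k --> \oo] --> l.
  apply: real_cauchy => e /uC [N NC]; exists N => k l Nk Nl.
  apply: le_trans (NC _ _ Nk Nl); apply: le_trans (csq_le _ x).
  rewrite l2D l2N; case: (u k x) (u l x) => a b [c d].
  by rewrite /complex_sqnorm /= lerDr sqr_ge0.
pose p x := projT1 (cid (reC x)); pose q x := projT1 (cid (imC x)).
pose h x := Complex (p x) (q x).
have hb (e : R) k : (\forall l \near \oo, sqn (u k - u l) <= e) ->
    forall F : {fset G}, \sum_(x <- F) csq (u k x - h x) <= e.
  move=> ke F.
  have K : (\sum_(x <- F) csq (u k x - u l x)) @[l --> \oo] -->
     \sum_(x <- F) csq (u k x - h x).
    apply: cvg_big => [|x _].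
      exact: (@add_continuous R^o).
    have -> : csq (u k x - h x) =
       (complex.Re (u k x) - p x) ^+ 2 + (complex.Im (u k x) - q x) ^+ 2.
      by case: (u k x).
    rewrite (_ : (fun l => _) = fun l => (complex.Re (u k x) - complex.Re (u l x)) ^+ 2 +
        (complex.Im (u k x) - complex.Im (u l x)) ^+ 2); last first.
      by apply/funext => l; case: (u k x) (u l x) => a b [c d].
    have pP : complex.Re (u l x) @[l --> \oo] --> p x := projT2 (cid (reC x)).
    have qP : complex.Im (u l x) @[l --> \oo] --> q x := projT2 (cid (imC x)).
    have X (c : R) (w : nat -> R) (z : R) : w @ \oo --> z ->
        (c - w l) ^+ 2 @[l --> \oo] --> (c - z) ^+ 2.
      move=> wz; have D : (c - w l) @[l --> \oo] --> c - z.
        by apply: cvgB => //; exact: cvg_cst.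
      exact: (cvgM D D).
    by apply: cvgD; exact: X.
  apply: (cvgr_to_le K); apply: filterS ke => l.
  exact: le_trans (sum_csq_le F (u k - u l)).
have ev e : 0 < e -> \forall k \near \oo, \forall l \near \oo, sqn (u k - u l) <= e.
  by move=> /uC [N NC]; exists N => // k /= Nk; exists N => // l /= Nl; exact: NC.
have [k0] : exists k0, \forall l \near \oo, sqn (u k0 - u l) <= 1.
  by have [N _ /(_ N (leqnn _)) ?] := ev 1 ltr01; exists N.
move=> /hb /l2_of_bound [g gE _].
pose v := u k0 - g.
have vE x : v x = h x by rewrite l2D l2N gE opprB addrC subrK.
exists v; apply/cvgrPdist_le => e /ev; apply: filterS => k /hb /l2_of_bound [f fE fe].
have -> : u k - v = f by apply: l2_eqP => x; rewrite l2D l2N vE fE.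
by rewrite sub0r normrN ger0_norm ?sqn_ge0.
Qed.

End Convergence.

(** * Adjoints and the trace *)

Section Adjoint.
Variables (R : realType) (G : groupType).
Local Notation H := (l2 R G).
Local Notation N := (group_vN R G).
Local Notation csq := (@complex_sqnorm R).
Local Notation delta := (l2_delta1 R G).
Implicit Types (f g h u v : H) (S T U : N) (k x y : G).

Lemma vN_lin T c f g : T (c *: f + g) = c *: T f + T g.
Proof. by have /asboolP[Tl _ _] := vN_opP T; exact: Tl. Qed.

Lemma vN_appD T f g : T (f + g) = T f + T g.
Proof. by have := vN_lin T 1 f g; rewrite !scale1r. Qed.

Lemma vN_app0 T : T 0 = 0.
Proof. by have := vN_appD T 0 0; rewrite addr0 -{1}[T 0]addr0 => /addrI. Qed.

Lemma vN_appZ T c f : T (c *: f) = c *: T f.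
Proof. by have := vN_lin T c f 0; rewrite vN_app0 !addr0. Qed.

Lemma vN_appN T f : T (- f) = - T f.
Proof. by rewrite -scaleN1r vN_appZ scaleN1r. Qed.

Lemma vN_appB T f g : T (f - g) = T f - T g.
Proof. by rewrite vN_appD vN_appN. Qed.

Lemma vN_app_sum T (I : Type) (r : seq I) (F : I -> H) :
  T (\sum_(i <- r) F i) = \sum_(i <- r) T (F i).
Proof. by elim/big_rec2: _ => [|i u v _ <-]; rewrite ?vN_app0 ?vN_appD. Qed.

Lemma vN_app_rt T k f : T (right_translate k f) = right_translate k (T f).
Proof. by have /asboolP[_ _ Tr] := vN_opP T. Qed.

Lemma vN_bound T : exists2 C : R, 0 < C & forall f, sqn (T f) <= C * sqn f.
Proof.
have /asboolP[_ [C C0 TC] _] := vN_opP T.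
exists (C + 1) => [|f]; first by rewrite ltr_pwDr.
apply: (@le_trans _ _ (C * sqn f)); first by rewrite -lee_fin EFinM -!sqnE.
by rewrite ler_wpM2r ?sqn_ge0 // lerDl.
Qed.

Lemma vN_build (t : H -> H) (C : R) : 0 <= C ->
  (forall c f g, t (c *: f + g) = c *: t f + t g) ->
  (forall f, sqn (t f) <= C * sqn f) ->
  (forall k f, t (right_translate k f) = right_translate k (t f)) ->
  exists T : N, forall f, T f = t f.
Proof.
move=> C0 tl tC tr; have tP : vN_pred t.
  apply/asboolP; split => //; exists C => // f.
  by rewrite !sqnE -EFinM lee_fin.
by exists (GroupVN tP).
Qed.

Lemma right_translateK k f : right_translate k^-1%g (right_translate k f) = f.
Proof. by apply: l2_eqP => x; rewrite !right_translateE mulgVK. Qed.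

Lemma right_translateD k f g :
  right_translate k (f + g) = right_translate k f + right_translate k g.
Proof. exact/val_inj. Qed.

Lemma ip_right_translate k f g :
  ip (right_translate k f) g = ip f (right_translate k^-1%g g).
Proof.
rewrite /ip -(sqn_right_translate k (f + _)) -(sqn_right_translate k (f - _)).
rewrite !right_translateD.
have -> : right_translate k (- right_translate k^-1%g g) = - g.
  by apply: l2_eqP => x; rewrite right_translateE !l2N right_translateE mulgK.
by have := right_translateK k^-1%g g; rewrite invgK => ->.
Qed.

Lemma ip_inj f g : (forall h, ip f h = ip g h) -> f = g.
Proof.
by move=> fg; apply/eqP; rewrite -subr_eq0; apply/eqP/ip_eq0 => h; rewrite ipBl fg subrr.
Qed.

(** The coordinates of the adjoint vector are forced: they are the products of [f]
    with the images of [pt x] and [i pt x].  Testing [T] on the truncations of this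
    coordinate family bounds their norms, hence the family is square-summable. *)
Lemma adjoint_vec T f : exists2 g : H, (forall h, ip g h = ip f (T h)) &
  forall C : R, 0 <= C -> (forall u, sqn (T u) <= C * sqn u) -> sqn g <= C * sqn f.
Proof.
pose a x := Complex (ip f (T (pt R x))) (ip f (T ('i%C *: pt R x))).
have aE (F : {fset G}) (h : G -> R[i]) :
    ip f (T (trunc F h)) = \sum_(x <- F) cdot (a x) (h x).
  rewrite /trunc vN_app_sum ip_sumr; apply: eq_bigr => x _.
  have -> : h x *: pt R x = Complex (complex.Re (h x)) 0 *: pt R x +
       Complex (complex.Im (h x)) 0 *: ('i%C *: pt R x).
    rewrite scalerA -scalerDl; congr (_ *: _).
    by case: (h x) => p q; apply/eqP; rewrite eq_complex /=; apply/andP; split;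
      apply/eqP; ring.
  rewrite vN_appD !(vN_appZ T (Complex _ 0)) ipDr !ipZr /cdot /=.
  by congr (_ + _); exact: mulrC.
have bnd (C : R) : 0 <= C -> (forall u, sqn (T u) <= C * sqn u) ->
    forall F : {fset G}, \sum_(x <- F) csq (a x) <= C * sqn f.
  move=> C0 TC F; have E := sqn_trunc F a.
  have E2 : ip f (T (trunc F a)) = sqn (trunc F a).
    by rewrite aE E; apply: eq_bigr => x _; rewrite cdotzz.
  rewrite -E; have := ip_CS f (T (trunc F a)); rewrite E2.
  have := TC (trunc F a); move: (sqn_ge0 (trunc F a)) (sqn_ge0 f).
  move: (sqn (trunc F a)) (sqn f) (sqn (T _)) => s p t s0 p0 ts sp.
  rewrite leNgt; apply/negP => lt; have s1 : 0 < s by apply: le_lt_trans lt; exact: mulr_ge0.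
  have : s ^+ 2 <= p * (C * s) by apply: le_trans sp _; rewrite ler_wpM2l.
  rewrite expr2 mulrA ler_pM2r // => ?; move: lt; rewrite ltNge => /negP; apply.
  by rewrite mulrC.
have [C0 C00 TC0] := vN_bound T.
have [g gE _] := l2_of_bound (bnd _ (ltW C00) TC0).
exists g.
  apply: (ip_trunc_ext (ltW C00)) => //; first by move=> u v; rewrite vN_appB.
  move=> F h; rewrite aE ip_trunc; apply: eq_bigr => x _; by rewrite gE.
move=> C C1 TC; have [g' g'E le] := l2_of_bound (bnd _ C1 TC).
by have -> : g = g' by apply: l2_eqP => x; rewrite gE g'E.
Qed.

Lemma adjoint_exists T : exists S : N, forall f h, ip (S f) h = ip f (T h).
Proof.
pose t f := projT1 (cid2 (adjoint_vec T f)).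
have tE f h : ip (t f) h = ip f (T h) by rewrite /t; case: cid2 => /= g gE _.
have [C C0 TC] := vN_bound T.
have [S SE] : exists S : N, forall f, S f = t f.
  apply: (@vN_build _ C) => [|c f g|f|k f]; first exact: ltW.
  - apply: ip_inj => h; rewrite ipDl tE !ipDl ipZ.
    by rewrite ipZ !tE vN_appZ.
  - by rewrite /t; case: cid2 => /= g _; apply => //; exact: ltW.
  - apply: ip_inj => h; rewrite tE ip_right_translate -vN_app_rt.
    by rewrite ip_right_translate tE.
by exists S => f h; rewrite SE tE.
Qed.

Definition star T : N := projT1 (cid (adjoint_exists T)).

Lemma starP T f h : ip (star T f) h = ip f (T h).
Proof. by rewrite /star; case: cid => S /=. Qed.

Lemma starPr T f h : ip f (star T h) = ip (T f) h.
Proof. by rewrite ipC starP ipC. Qed.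

Lemma vN_eqP S T : (forall f, S f = T f) -> S = T.
Proof. by move=> ST; apply/val_inj/funext. Qed.

Lemma vN_mulE S T f : (S * T) f = S (T f). Proof. by []. Qed.
Lemma vN_oneE f : (1 : N) f = f. Proof. by []. Qed.
Lemma vN_addE S T f : (S + T) f = S f + T f. Proof. by []. Qed.
Lemma vN_oppE T f : (- T) f = - T f. Proof. by []. Qed.
Lemma vN_zeroE f : (0 : N) f = 0. Proof. by []. Qed.
Lemma vN_ipP S T : (forall f h, ip (S f) h = ip (T f) h) -> S = T.
Proof. by move=> ST; apply: vN_eqP => f; apply: ip_inj. Qed.

Lemma starK T : star (star T) = T.
Proof. by apply: vN_ipP => f h; rewrite starP starPr. Qed.

Lemma starM S T : star (S * T) = star T * star S.
Proof. by apply: vN_ipP => f h; rewrite starP !vN_mulE !starP. Qed.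

Lemma starD S T : star (S + T) = star S + star T.
Proof. by apply: vN_ipP => f h; rewrite starP !vN_addE ipDl ipDr !starP. Qed.

Lemma starN T : star (- T) = - star T.
Proof. by apply: vN_ipP => f h; rewrite starP !vN_oppE ipNl ipNr !starP. Qed.

Lemma starB S T : star (S - T) = star S - star T.
Proof. by rewrite starD starN. Qed.

Lemma star1 : star 1 = 1.
Proof. by apply: vN_ipP => f h; rewrite starP. Qed.

Lemma star0 : star 0 = 0.
Proof. by apply: vN_ipP => f h; rewrite starP !vN_zeroE ip0r ip0l. Qed.

Lemma starX T n : star (T ^+ n) = star T ^+ n.
Proof. by elim: n => [|n IH]; rewrite ?expr0 ?star1 // exprS exprSr starM IH. Qed.

Lemma vN_app_pt T x : T (pt R x) = right_translate x^-1%g (T delta).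
Proof. exact: vN_app_rt. Qed.

(** The unit vector separates [N]: its right translates span a dense subspace. *)
Lemma vN_delta0 T : T delta = 0 -> T = 0.
Proof.
move=> T0; apply: vN_ipP => f h; rewrite vN_zeroE ip0l ipC -(ip0l f).
have [C C0 TC] := vN_bound T; apply/esym; apply: (ip_trunc_ext (ltW C0)) => //.
  by move=> u v; rewrite vN_appB.
move=> F a; rewrite ip0l /trunc vN_app_sum big1 ?ip0r // => x _.
rewrite vN_appZ vN_app_pt T0.
by have -> : right_translate x^-1%g 0 = 0 :> H; [exact: l2_eqP | rewrite scaler0].
Qed.

(** The real part of the von Neumann trace. *)
Definition tau T : R := ip (T delta) delta.

(** The squared 2-norm of the trace, [n2 T = tau (star T * T)]. *)
Definition n2 T : R := sqn (T delta).

Fact square_summable_flip f :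
  square_summable ((fun x : G => ((f x^-1%g)^*)%C) : G -> (R[i])^o).
Proof.
apply/asboolP; rewrite (_ : l2_sqnorm _ = l2_sqnorm (f \o (fun x : G => x^-1%g))).
  rewrite l2_sqnorm_reindex; first by rewrite sqnE ltry.
  by exists (fun x : G => x^-1%g); exact: invgK.
apply: eq_esum => x _ /=; case: (f x^-1%g) => a b.
by rewrite /complex_sqnorm /= sqrrN.
Qed.

(** The modular conjugation of the regular representation. *)
Definition flip f : H := L2 (square_summable_flip f).

Lemma flipE f x : flip f x = ((f x^-1%g)^*)%C. Proof. by []. Qed.

Lemma flipK f : flip (flip f) = f.
Proof. by apply: l2_eqP => x; rewrite !flipE invgK conjcK. Qed.

Lemma sqn_flip f : sqn (flip f) = sqn f.
Proof.
rewrite /sqn; congr fine; rewrite (_ : l2_sqnorm _ = l2_sqnorm (f \o (fun x : G => x^-1%g))).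
  by rewrite l2_sqnorm_reindex //; exists (fun x : G => x^-1%g); exact: invgK.
apply: eq_esum => x _; rewrite flipE /=; case: (f x^-1%g) => a b.
by rewrite /complex_sqnorm /= sqrrN.
Qed.

Lemma ip_flip f g : ip (flip f) (flip g) = ip f g.
Proof.
have E1 : flip f + flip g = flip (f + g).
  by apply: l2_eqP => x; rewrite l2D !flipE l2D rmorphD.
have E2 : flip f - flip g = flip (f - g).
  by apply: l2_eqP => x; rewrite l2D l2N !flipE l2D l2N rmorphB.
by rewrite /ip E1 E2 !sqn_flip.
Qed.

(** Because [T] commutes with right translations, its matrix is
    determined by [T delta], and the adjoint conjugates and inverts this column. *)
Lemma star_delta T : star T delta = flip (T delta).
Proof.
have ip_val f g : (forall x z, cdot (f x) z = cdot (g x) z) -> f = g.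
  move=> fg; apply: l2_eqP => x; have := fg x 1; have := fg x 'i%C.
  rewrite /cdot /=; case: (f x) (g x) => a b [c d] /=.
  by rewrite !mulr0 !mulr1 !addr0 !add0r => -> ->.
apply: ip_val => x z; rewrite -ip_pt starP vN_appZ vN_app_pt.
rewrite ipC ipZ ip_right_translate invgK.
have -> : right_translate x ((z^*)%C *: delta) = (z^*)%C *: pt R x^-1%g.
  by apply: l2_eqP => y; rewrite /pt invgK.
rewrite ip_pt flipE /cdot; case: (T delta _) z => a b [c d] /=; ring.
Qed.

(** Both traces are products of the vectors [S delta] and [T delta], one of them
    flipped, and the flip is an isometric involution. *)
Lemma tauC S T : tau (S * T) = tau (T * S).
Proof.
rewrite /tau !vN_mulE -[LHS]starPr -[RHS]starPr !star_delta.
by rewrite -(ip_flip (T delta)) flipK ipC.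
Qed.

End Adjoint.

(** * Matrices over the von Neumann algebra acting on powers of l2 *)

Section Matrices.
Variables (R : realType) (G : groupType).
Local Notation H := (l2 R G).
Local Notation N := (group_vN R G).
Local Notation delta := (l2_delta1 R G).
Implicit Types (f g h : H) (S T U : N).

Lemma tauD S T : tau (S + T) = tau S + tau T.
Proof. exact: ipDl. Qed.

Lemma tauB S T : tau (S - T) = tau S - tau T.
Proof. exact: ipBl. Qed.

Lemma tau0 : tau (0 : N) = 0.
Proof. exact: ip0l. Qed.

Lemma tau1 : tau (1 : N) = 1.
Proof. by rewrite /tau ip_sqn -(sqn_right_translate 1^-1%g) -/(pt R 1%g) sqn_pt. Qed.

Lemma tau_sum (I : Type) (r : seq I) (F : I -> N) :
  tau (\sum_(i <- r) F i) = \sum_(i <- r) tau (F i).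
Proof. by elim/big_rec2: _ => [|i x y _ <-]; rewrite ?tau0 ?tauD. Qed.

Lemma n2_tau T : n2 T = tau (star T * T).
Proof. by rewrite /tau vN_mulE starP ip_sqn. Qed.

Lemma n2_star T : n2 (star T) = n2 T.
Proof. by rewrite !n2_tau starK tauC. Qed.

Lemma n2_ge0 T : 0 <= n2 T. Proof. exact: sqn_ge0. Qed.

Definition star_mx m n (A : 'M[N]_(m, n)) : 'M[N]_(n, m) := \matrix_(i, j) star (A j i).

Definition act m n (A : 'M[N]_(m, n)) (w : 'I_n -> H) : 'I_m -> H :=
  fun i => \sum_j A i j (w j).

Definition ipn m (w v : 'I_m -> H) : R := \sum_i ip (w i) (v i).
Definition sqnn m (w : 'I_m -> H) : R := \sum_i sqn (w i).
Definition mtau m (A : 'M[N]_m) : R := \sum_i tau (A i i).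

Lemma vN_sumE (I : Type) (r : seq I) (F : I -> N) f :
  (\sum_(i <- r) F i) f = \sum_(i <- r) F i f.
Proof. by elim/big_rec2: _ => [|i x y _ <-]. Qed.

Lemma act_mul m n p (A : 'M[N]_(m, n)) (B : 'M[N]_(n, p)) w :
  act (A *m B) w = act A (act B w).
Proof.
apply/funext => i; rewrite /act.
under [RHS]eq_bigr do rewrite vN_app_sum.
rewrite exchange_big /=; apply: eq_bigr => j _.
by rewrite mxE vN_sumE.
Qed.

Lemma act_sub m n (A B : 'M[N]_(m, n)) w : act (A - B) w = fun i => act A w i - act B w i.
Proof.
by apply/funext => i; rewrite /act -sumrB; apply: eq_bigr => j _; rewrite !mxE.
Qed.

Definition unitv m (j : 'I_m) f : 'I_m -> H := fun i => if i == j then f else 0.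

Lemma act_unitv m n (A : 'M[N]_(m, n)) j f i : act A (unitv j f) i = A i j f.
Proof.
rewrite /act (bigD1 j) //= {1}/unitv eqxx big1 ?addr0 // => k /negbTE kj.
by rewrite /unitv kj vN_app0.
Qed.

Lemma sqnn_unitv m (j : 'I_m) f : sqnn (unitv j f) = sqn f.
Proof.
rewrite /sqnn (bigD1 j) //= {1}/unitv eqxx big1 ?addr0 // => k /negbTE kj.
by rewrite /unitv kj sqn0.
Qed.

Lemma act_inj m n (A B : 'M[N]_(m, n)) : (forall w, act A w = act B w) -> A = B.
Proof.
by move=> AB; apply/matrixP => i j; apply: vN_eqP => f; rewrite -!act_unitv AB.
Qed.

Lemma act1 m (w : 'I_m -> H) : act 1%:M w = w.
Proof.
apply/funext => i; rewrite /act (bigD1 i) //= mxE eqxx big1 ?addr0 // => j.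
by rewrite eq_sym mxE => /negbTE ->.
Qed.

Lemma ipn_sqnn m (w : 'I_m -> H) : ipn w w = sqnn w.
Proof. by apply: eq_bigr => i _; rewrite ip_sqn. Qed.

Lemma ipnC m (w v : 'I_m -> H) : ipn w v = ipn v w.
Proof. by apply: eq_bigr => i _; rewrite ipC. Qed.

Lemma sqnnB m (w v : 'I_m -> H) :
  sqnn (fun i => w i - v i) = sqnn w - 2 * ipn w v + sqnn v.
Proof.
rewrite /sqnn /ipn mulr_sumr -sumrB -big_split /=.
by apply: eq_bigr => i _; rewrite sqnB.
Qed.

Lemma sqnn_ge0 m (w : 'I_m -> H) : 0 <= sqnn w.
Proof. by apply: sumr_ge0 => i _; exact: sqn_ge0. Qed.

Lemma sqn_le_sqnn m (w : 'I_m -> H) i : sqn (w i) <= sqnn w.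
Proof.
by rewrite /sqnn (bigD1 i) //= lerDl sumr_ge0 // => j _; exact: sqn_ge0.
Qed.

Lemma ipn_act m n (A : 'M[N]_(m, n)) w v : ipn (act A w) v = ipn w (act (star_mx A) v).
Proof.
rewrite /ipn /act; under eq_bigr do rewrite ip_suml.
under [RHS]eq_bigr do rewrite ip_sumr.
rewrite exchange_big /=; apply: eq_bigr => i _; apply: eq_bigr => j _.
by rewrite mxE starPr.
Qed.

Lemma star_mxK m n (A : 'M[N]_(m, n)) : star_mx (star_mx A) = A.
Proof. by apply/matrixP => i j; rewrite !mxE starK. Qed.

Lemma star_sum (I : Type) (r : seq I) (F : I -> N) :
  star (\sum_(i <- r) F i) = \sum_(i <- r) star (F i).
Proof. by elim/big_rec2: _ => [|i x y _ <-]; rewrite ?star0 ?starD. Qed.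

Lemma star_mxM m n p (A : 'M[N]_(m, n)) (B : 'M[N]_(n, p)) :
  star_mx (A *m B) = star_mx B *m star_mx A.
Proof.
apply/matrixP => i j; rewrite !mxE star_sum; apply: eq_bigr => k _.
by rewrite starM !mxE.
Qed.

Lemma star_mxB m n (A B : 'M[N]_(m, n)) : star_mx (A - B) = star_mx A - star_mx B.
Proof. by apply/matrixP => i j; rewrite !mxE starB. Qed.

Lemma star_mx1 m : star_mx (1%:M : 'M[N]_m) = 1%:M.
Proof.
by apply/matrixP => i j; rewrite !mxE eq_sym; case: (i == j); rewrite ?star1 ?star0.
Qed.

Lemma star_mxX m (A : 'M[N]_m) k : star_mx A = A -> star_mx (A ^+ k) = A ^+ k.
Proof.
move=> sA; elim: k => [|k IH]; first exact: star_mx1.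
by rewrite {1}exprS star_mxM IH sA; exact: (esym (exprSr A k)).
Qed.

Lemma mtauC m n (A : 'M[N]_(m, n)) (B : 'M[N]_(n, m)) : mtau (A *m B) = mtau (B *m A).
Proof.
rewrite /mtau; under eq_bigr do rewrite mxE tau_sum.
under [RHS]eq_bigr do rewrite mxE tau_sum.
rewrite exchange_big /=; apply: eq_bigr => i _; apply: eq_bigr => j _.
exact: tauC.
Qed.

Lemma mtauB m (A B : 'M[N]_m) : mtau (A - B) = mtau A - mtau B.
Proof. by rewrite /mtau -sumrB; apply: eq_bigr => i _; rewrite !mxE tauB. Qed.

Lemma mtau1 m : mtau (1%:M : 'M[N]_m) = m%:R.
Proof.
rewrite /mtau (eq_bigr (fun=> 1)) ?sumr_const ?card_ord // => i _.
by rewrite mxE eqxx tau1.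
Qed.

Lemma mtau_star_mul_ge0 m n (A : 'M[N]_(m, n)) : 0 <= mtau (star_mx A *m A).
Proof.
apply: sumr_ge0 => i _; rewrite mxE tau_sum; apply: sumr_ge0 => j _.
by rewrite mxE -n2_tau n2_ge0.
Qed.

Lemma cvg2_sum (I : Type) (r : seq I) (u : I -> nat -> H) (v : I -> H) :
  (forall i, cvg2 (u i) (v i)) ->
  cvg2 (fun k => \sum_(i <- r) u i k) (\sum_(i <- r) v i).
Proof.
move=> uv; elim: r => [|i r IH].
  rewrite big_nil (_ : (fun k => _) = fun=> 0); first exact: cvg2_cst.
  by apply/funext => k; rewrite big_nil.
rewrite big_cons (_ : (fun k => _) = fun k => u i k + \sum_(j <- r) u j k).
  exact: cvg2D.
by apply/funext => k; rewrite big_cons.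
Qed.

Lemma cvg2_app T (u : nat -> H) v : cvg2 u v -> cvg2 (fun k => T (u k)) (T v).
Proof.
have [C C0 TC] := vN_bound T; apply: (cvg2_op (T := vN_op T) _ TC) => f g.
exact: vN_appB.
Qed.

Lemma cvg2_act m n (A : 'M[N]_(m, n)) (u : nat -> 'I_n -> H) w i :
  (forall j, cvg2 (u^~ j) (w j)) -> cvg2 (fun k => act A (u k) i) (act A w i).
Proof. by move=> uw; apply: cvg2_sum => j; exact: cvg2_app. Qed.

End Matrices.

(** * The projection onto the kernel of an adjoint *)

Section KernelProjection.
Variables (R : realType) (G : groupType).
Local Notation H := (l2 R G).
Local Notation N := (group_vN R G).
Implicit Types (f g h : H) (S T U : N).

(** Beyond an index where [a] is within [e] of its infimum, all gaps are at most [e]. *)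
Lemma nonincreasing_gap (a : nat -> R) : (forall k, a k.+1 <= a k) -> (forall k, 0 <= a k) ->
  forall e : R, 0 < e -> exists n, forall k l, (n <= k)%N -> (n <= l)%N -> a k - a l <= e.
Proof.
move=> aS a0 e e0; have amono k l : (k <= l)%N -> a l <= a k.
  by move/subnK <-; elim: (l - k)%N => // d; apply: le_trans; rewrite addSn.
have [|_ [n _ <-] an] := @inf_adherent R (range a) e e0.
  by split; [exists (a 0%N), 0%N | exists 0 => _ [k _ <-]].
exists n => k l nk nl.
have : inf (range a) <= a l.
  by apply: ge_inf; [exists 0 => _ [j _ <-] | exists l].
by have := amono _ _ nk; lra.
Qed.

(** Linearity, equivariance and, up to a factor 2, the bound pass to the pointwise
    limit. *)
Lemma strong_limit (x_ : nat -> N) (C : R) : 0 <= C ->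
  (forall k f, sqn (x_ k f) <= C * sqn f) ->
  (forall f, exists v, cvg2 (fun k => x_ k f) v) ->
  exists x : N, forall f, cvg2 (fun k => x_ k f) (x f).
Proof.
move=> C0 xC xv; pose t f := projT1 (cid (xv f)).
have tP f : cvg2 (fun k => x_ k f) (t f) by rewrite /t; case: cid.
have cvgZ (c : R[i]) u v : cvg2 u v -> cvg2 (fun k => c *: u k) (c *: v : H).
  apply: (cvg2_op (T := fun f => c *: f) (C := complex_sqnorm c)).
    by move=> f g; rewrite scalerBr.
  by move=> f; rewrite sqnZ.
have [x xE] : exists x : N, forall f, x f = t f.
  apply: (@vN_build _ _ _ (2 * C)) => [|c f g|f|k f].
  - by rewrite mulr_ge0.
  - apply: (@cvg2_unique _ _ (fun k => x_ k (c *: f + g))); first exact: tP.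
    rewrite (_ : (fun k => _) = fun k => c *: x_ k f + x_ k g); last first.
      by apply/funext => k; rewrite vN_lin.
    by apply: cvg2D => //; exact: cvgZ.
  - have K : (2 * sqn (x_ k f - t f) + 2 * (C * sqn f)) @[k --> \oo] -->
        (2 * 0 + 2 * (C * sqn f)).
      by apply: cvgD; [apply: cvgMl_tmp; exact: tP | exact: cvg_cst].
    rewrite mulr0 add0r mulrA in K; apply: (cvgr_to_ge K); apply: nearW => k.
    have := sqnD_le (t f - x_ k f) (x_ k f); rewrite subrK -opprB sqnN => le.
    apply: le_trans le _.
    by rewrite lerD2l -mulrA ler_wpM2l.
  - apply: (@cvg2_unique _ _ (fun j => x_ j (right_translate k f))); first exact: tP.
    rewrite (_ : (fun j => _) = fun j => right_translate k (x_ j f)); last first.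
      by apply/funext => j; rewrite vN_app_rt.
    apply: (cvg2_op (T := @right_translate R G k) (C := 1)) => //.
      by move=> u v; rewrite right_translateB.
    by move=> u; rewrite mul1r sqn_right_translate.
by exists x => f; rewrite xE.
Qed.

Section Contraction.
Variables (m n : nat) (V : 'M[N]_(m, n)).
Hypothesis V_contraction : forall w, sqnn (act V w) <= sqnn w.

Local Notation V' := (star_mx V).
Local Notation M := (1%:M - V *m V').

Let starM_ : star_mx M = M.
Proof. by rewrite star_mxB star_mx1 star_mxM star_mxK. Qed.

Let sqnn_M w : sqnn (act M w) = sqnn w - 2 * sqnn (act V' w) + sqnn (act V (act V' w)).
Proof.
rewrite act_sub sqnnB act1 act_mul; congr (_ - 2 * _ + _).
by rewrite ipnC ipn_act ipn_sqnn.
Qed.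

Let sqnn_M_le w : sqnn (act M w) <= sqnn w - sqnn (act V' w).
Proof. by rewrite sqnn_M; have := V_contraction (act V' w); lra. Qed.

Let expM_sqnn a b w v : ipn (act (M ^+ a) w) (act (M ^+ b) v) = ipn w (act (M ^+ (a + b)) v).
Proof. by rewrite ipn_act star_mxX // exprD act_mul. Qed.

(** As [M] is a self-adjoint contraction, [<M^2k w, M^2l w> = |M^(k+l) w|^2], so the
    even powers form a Cauchy sequence at [w] because the numbers [|M^j w|^2]
    decrease to a limit. *)
Let norms w k := sqnn (act (M ^+ k) w).

Let norms_nonincreasing w k : norms w k.+1 <= norms w k.
Proof.
rewrite /norms exprS act_mul; apply: le_trans (sqnn_M_le _) _.
by rewrite gerBl sqnn_ge0.
Qed.

Let powers_dist w k l :
  sqnn (fun i => act (M ^+ (k + k)) w i - act (M ^+ (l + l)) w i) =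
  norms w (k + k) - 2 * norms w (k + l) + norms w (l + l).
Proof.
rewrite sqnnB; congr (_ - 2 * _ + _).
by rewrite /norms -ipn_sqnn !expM_sqnn addnACA.
Qed.

Let powers_cauchy w (e : R) : 0 < e -> exists q, forall k l, (q <= k)%N -> (q <= l)%N ->
  sqnn (fun i => act (M ^+ (k + k)) w i - act (M ^+ (l + l)) w i) <= e.
Proof.
move=> e0; have [|||q qP] := @nonincreasing_gap (norms w) _ _ (e / 2).
- exact: norms_nonincreasing.
- by move=> k; exact: sqnn_ge0.
- by rewrite divr_gt0.
exists q => k l qk ql; rewrite powers_dist.
have := qP (k + k)%N (k + l)%N; have := qP (l + l)%N (k + l)%N.
rewrite !(leq_trans qk (leq_addr _ _)) (leq_trans ql (leq_addr _ _)).
by move=> /(_ isT isT) ? /(_ isT isT) ?; lra.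
Qed.

Let entry_limit i j : exists x : N, forall f, cvg2 (fun k => (M ^+ (k + k)) i j f) (x f).
Proof.
apply: (@strong_limit _ 1) => // [k f|f].
  rewrite mul1r -act_unitv -(sqnn_unitv j f); apply: le_trans (sqn_le_sqnn _ _) _.
  elim: (k + k)%N => [|d IH]; first by rewrite act1.
  exact: le_trans (norms_nonincreasing _ _) IH.
apply: l2_complete => e /(powers_cauchy (unitv j f)) [q qP]; exists q => k l qk ql.
apply: le_trans (qP k l qk ql); rewrite -!act_unitv.
exact: (@sqn_le_sqnn _ _ _ (fun i => _ - _)).
Qed.

(** [K] is the strong limit of [M^(2k)] for [M = 1 - V V^*].  A vector fixed by [M^2]
    keeps its norm under [M], which loses at least [|V^* w|^2], so [V^* K = 0].  For
    the trace, [M^k V = V B^k] with [B = 1 - V^* V] gives by induction that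
    [M^k] and [B^k] differ in trace by [m - n], and [B^(2k)] is a square. *)
Lemma kernel_projection : exists K : 'M[N]_m,
  [/\ star_mx K = K, K *m K = K, K *m V = 0 & m%:R - n%:R <= mtau K].
Proof.
pose K : 'M[N]_m := \matrix_(i, j) projT1 (cid (entry_limit i j)).
have KP i j f : cvg2 (fun k => (M ^+ (k + k)) i j f) (K i j f).
  by rewrite mxE; case: cid.
have actK w i : cvg2 (fun k => act (M ^+ (k + k)) w i) (act K w i).
  by apply: cvg2_sum => j; exact: KP.
have sK : star_mx K = K.
  apply/matrixP => i j; rewrite mxE; apply: vN_ipP => f h; rewrite starP ipC.
  have L1 := cvg2_ip (w := f) (KP j i h); have L2 := cvg2_ip (w := h) (KP i j f).
  apply: (cvg_unique _ L1 _) => //.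
  rewrite (_ : (fun k => _) = fun k => ip ((M ^+ (k + k)) i j f) h) //.
  apply/funext => k.
  have <- : star ((M ^+ (k + k)) j i) = (M ^+ (k + k)) i j.
    by rewrite -[in RHS](star_mxX (k + k) starM_) [RHS]mxE.
  by rewrite starP ipC.
have MMK : M ^+ 2 *m K = K.
  apply: act_inj => w; apply/funext => i.
  apply: (@cvg2_unique _ _ (fun k => act (M ^+ (k.+1 + k.+1)) w i)).
    rewrite act_mul (_ : (fun k => _) = fun k => act (M ^+ 2) (act (M ^+ (k + k)) w) i).
      by apply: cvg2_act => j; exact: actK.
    by apply/funext => k; rewrite addSn addnS -(add2n (k + k)) exprD act_mul.
  rewrite (_ : (fun k => _) = fun k => act (M ^+ ((k + 1) + (k + 1))) w i); last first.
    by apply/funext => k; rewrite !addn1.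
  exact: (cvg2_shift 1 (actK w i)).
have fixV w : act M (act M w) = w -> act V' w = fun=> 0.
  move=> Mw; have := sqnn_M_le (act M w); rewrite Mw.
  have := sqnn_M_le w; have := sqnn_ge0 (act V' (act M w)).
  have := sqnn_ge0 (act V' w) => *.
  have W0 : sqnn (act V' w) <= 0 by lra.
  apply/funext => i; apply: sqn_eq0; apply: le_trans W0; exact: sqn_le_sqnn.
have V'K : V' *m K = 0.
  apply: act_inj => w; rewrite act_mul fixV.
    by apply/funext => i; rewrite /act big1 // => j _; rewrite mxE vN_zeroE.
  by rewrite -!act_mul -[M *m M](expr2 M) MMK.
have MK : M *m K = K by rewrite mulmxBl mul1mx -mulmxA V'K mulmx0 subr0.
have MkK k : M ^+ k *m K = K.
  by elim: k => [|k IH]; [exact: mul1mx | rewrite exprSr -mulmxA MK].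
exists K; split => //.
- apply: act_inj => w; apply/funext => i.
  apply: (@cvg2_unique _ _ (fun k => act (M ^+ (k + k)) (act K w) i)).
    by rewrite act_mul; exact: actK.
  rewrite (_ : (fun k => _) = fun=> act K w i); first exact: cvg2_cst.
  by apply/funext => k; rewrite -act_mul MkK.
- by rewrite -[K *m V]star_mxK star_mxM sK V'K; apply/matrixP => i j; rewrite !mxE star0.
pose B : 'M[N]_n := 1%:M - V' *m V.
have MV k : M ^+ k *m V = V *m B ^+ k.
  elim: k => [|k IH]; first by rewrite mul1mx mulmx1.
  rewrite exprSr -mulmxA [M *m V](_ : _ = V *m B).
    by rewrite mulmxA IH -mulmxA exprSr.
  by rewrite mulmxBl mulmxBr mul1mx mulmx1 mulmxA.
have tauM k : mtau (M ^+ k) - mtau (B ^+ k) = m%:R - n%:R.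
  elim: k => [|k <-]; first by rewrite !mtau1.
  have -> : M ^+ k.+1 = M ^+ k - M ^+ k *m V *m V'.
    by rewrite exprSr [_ * _]mulmxBr mulmx1 mulmxA.
  have -> : B ^+ k.+1 = B ^+ k - B ^+ k *m V' *m V.
    by rewrite exprSr [_ * _]mulmxBr mulmx1 mulmxA.
  have E : mtau (M ^+ k *m V *m V') = mtau (B ^+ k *m V' *m V).
    by rewrite MV [LHS]mtauC -[in RHS]mulmxA [RHS]mtauC mulmxA.
  by rewrite !mtauB E opprB [LHS]addrA subrK.
have lim_tau : mtau (M ^+ (k + k)) @[k --> \oo] --> mtau K.
  apply: cvg_big => [|i _]; first exact: (@add_continuous R^o).
  exact: cvg2_ip.
apply: (cvgr_to_ge lim_tau); apply: nearW => k.
rewrite -(tauM (k + k)%N) lerBlDr lerDl exprD.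
have sB : star_mx B = B by rewrite star_mxB star_mx1 star_mxM star_mxK.
by rewrite -{1}(star_mxX k sB) mtau_star_mul_ge0.
Qed.

End Contraction.
End KernelProjection.

(** * The approximate Ore condition *)

Section Ore.
Variables (R : realType) (G : groupType).
Local Notation H := (l2 R G).
Local Notation N := (group_vN R G).
Local Notation delta := (l2_delta1 R G).
Implicit Types (f g h : H) (a b r s p q y S T U : N).

Lemma vN_scalar (c : R) : exists T : N, forall f, T f = Complex c 0 *: f.
Proof.
apply: (@vN_build R G _ (complex_sqnorm (Complex c 0))) => [|d f g|f|k f].
- exact: complex_sqnorm_ge0.
- by rewrite scalerDr !scalerA mulrC.
- by rewrite sqnZ.
- exact: l2_eqP.
Qed.

(** Rescaling makes the column [(a; r)] a contraction, as [kernel_projection]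
    requires; the scalar cancels from the relations of [block_projection]. *)
Lemma contractive_multiple a r : exists2 l : R, 0 < l &
  forall f, sqn (Complex l 0 *: a f) + sqn (Complex l 0 *: r f) <= sqn f.
Proof.
have [C C0 aC] := vN_bound a; have [D D0 rD] := vN_bound r.
pose E := 1 + C + D; have E0 : 0 < E by rewrite /E; lra.
exists E^-1 => [|f]; first by rewrite invr_gt0.
rewrite !sqnZ -mulrDr /complex_sqnorm /= expr0n addr0.
have -> : E^-1 ^+ 2 * (sqn (a f) + sqn (r f)) = (sqn (a f) + sqn (r f)) / E ^+ 2.
  by rewrite mulrC exprVn.
rewrite ler_pdivrMr ?exprn_gt0 //.
have := aC f; have := rD f; have := sqn_ge0 f; rewrite /E.
move: (sqn f) (sqn (a f)) (sqn (r f)) => x u v x0 vD uC.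
have := mulr_ge0 (ltW C0) x0; have := mulr_ge0 (ltW D0) x0.
have : 0 <= x * C ^+ 2 by rewrite mulr_ge0 ?sqr_ge0.
have : 0 <= x * D ^+ 2 by rewrite mulr_ge0 ?sqr_ge0.
have : 0 <= x * C * D by rewrite !mulr_ge0 // ltW.
nra.
Qed.

Lemma block_projection a r : exists s q p y,
  [/\ [/\ star s = s, star p = q & star y = y],
      [/\ s * s + q * p = s, s * q + q * y = q & p * q + y * y = y],
      s * a + q * r = 0, p * a + y * r = 0 & 1 <= tau s + tau y].
Proof.
have [l l0 lar] := contractive_multiple a r; have [L LE] := vN_scalar l.
pose V : 'M[N]_(2, 1) := \matrix_(i, j) (L * if i == ord0 then a else r).
have [w|K [sK KK KV tK]] := @kernel_projection R G 2 1 V.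
  rewrite /sqnn /act !big_ord_recl !big_ord0 !addr0 !mxE /= !vN_mulE !LE.
  exact: lar.
pose i0 : 'I_2 := ord0; pose i1 : 'I_2 := lift ord0 ord0.
have entK i j : K i i0 * K i0 j + K i i1 * K i1 j = K i j.
  by rewrite -[in RHS]KK mxE !big_ord_recl big_ord0 addr0.
have stK i j : star (K j i) = K i j by rewrite -[in RHS]sK mxE.
have KV0 i : K i i0 * a + K i i1 * r = 0.
  apply: vN_eqP => f; have := congr1 (fun A : 'M[N]_(2, 1) => A i ord0 f) KV.
  rewrite !mxE !big_ord_recl big_ord0 addr0 !mxE /= !vN_addE !vN_mulE !LE !vN_appZ.
  rewrite -scalerDr => /(congr1 (fun g => (Complex l 0)^-1 *: g)).
  rewrite scalerA mulVf ?scale1r ?scaler0 //.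
  by rewrite eq_complex /= negb_and gt_eqF.
have tK' : 1 <= tau (K i0 i0) + tau (K i1 i1).
  have <- : mtau K = tau (K i0 i0) + tau (K i1 i1).
    by rewrite /mtau big_ord_recl big_ord1.
  by apply: le_trans tK; rewrite mulr2n addrK.
exists (K i0 i0), (K i0 i1), (K i1 i0), (K i1 i1); split.
- by split; exact: stK.
- by split; exact: entK.
- exact: KV0.
- exact: KV0.
- exact: tK'.
Qed.

(** For the complementary corners of a projection, [sigma = 1 - s] and [y] have
    the same moments up to a constant: [s sigma = q p] and [y (1 - y) = p q], and
    [q] intertwines [sigma] and [y]. *)
Lemma corner_moments s q p y k :
  s * s + q * p = s -> s * q + q * y = q -> p * q + y * y = y ->
  tau ((1 - s) ^+ k.+1) = 1 - tau s - tau y + tau (y ^+ k.+1).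
Proof.
move=> Es Eq Ey; pose z := 1 - s.
have zq : z * q = q * y by rewrite mulrBl mul1r -{1}Eq addrC addKr.
have zkq d : z ^+ d * q = q * y ^+ d.
  elim: d => [|d IH]; first by rewrite !expr0 mul1r mulr1.
  by rewrite exprSr -mulrA zq mulrA IH -mulrA -exprSr.
have qp : q * p = z - z * z.
  rewrite -[X in X - _]mulr1 -mulrBr opprB addrCA subrr addr0 mulrBl mul1r.
  by rewrite -[X in X - _ * _]Es addrC addKr.
have pq : p * q = y - y * y by rewrite -[X in X - _ * _]Ey addrK.
have X (x : N) d : x ^+ d * (x - x * x) = x ^+ d.+1 - x ^+ d.+2.
  by rewrite mulrBr mulrA -exprSr -exprSr.
have tz : tau z = 1 - tau s by rewrite tauB tau1.
rewrite -/z; clearbody z; elim: k => [|k IH].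
  by rewrite !expr1 tz subrK.
have E : tau (z ^+ k * (q * p)) = tau (y ^+ k * (p * q)).
  by rewrite [in LHS]mulrA zkq -[in LHS]mulrA [LHS]tauC -[in LHS]mulrA.
rewrite qp pq !X !tauB in E.
have A (u v w x c : R) : u = c + v -> u - w = v - x -> w = c + x.
  by clear; lra.
exact: A IH E.
Qed.

Lemma n2X_self y k : star y = y -> n2 (y ^+ k) = tau (y ^+ (k + k)).
Proof. by move=> sy; rewrite n2_tau starX sy exprD. Qed.

(** [y = p q + y^2] with [p = q^*] reads [<y f, f> = |q f|^2 + |y f|^2]; both bounds
    follow by Cauchy-Schwarz. *)
Lemma corner_bounds p q y f : star y = y -> star p = q -> p * q + y * y = y ->
  sqn (y f) <= sqn f /\ sqn (q f) <= sqn f - sqn (y f).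
Proof.
move=> sy sp Ey; have E : ip (y f) f = sqn (q f) + sqn (y f).
  rewrite -{1}Ey vN_addE ipDl !vN_mulE; congr (_ + _); rewrite -ip_sqn.
    by rewrite -starPr sp.
  by rewrite -starPr sy.
have := ip_CS (y f) f; rewrite E.
move: (sqn_ge0 (q f)) (sqn_ge0 (y f)) (sqn_ge0 f).
move: (sqn (q f)) (sqn (y f)) (sqn f); clear=> u x w u0 x0 w0 h.
have xw : x <= w.
  rewrite leNgt; apply/negP => wx; have x1 : 0 < x by apply: le_lt_trans wx.
  have : x ^+ 2 <= x * w.
    by apply: le_trans h; rewrite ler_sqr ?nnegrE ?addr_ge0 // lerDr.
  by rewrite expr2 ler_pM2l // leNgt wx.
split=> //; have : (u + x) ^+ 2 <= w ^+ 2.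
  by apply: le_trans h _; rewrite expr2 ler_wpM2r.
rewrite ler_sqr ?nnegrE ?addr_ge0 //; lra.
Qed.

(** Put [w = y^(k+1) delta].  As the norms of [y^k delta] decrease, [q y^k delta]
    becomes small by [corner_bounds], and then so does
    [r^* w = - a^* q y^k delta].  Thus [|w|^2] is close to [<(1 - r^* ) w, w>], which by
    the trace property is [<y^(2k+2) delta, (1 - r) delta>], at most
    [|w| |(1 - r) delta|]. *)
Lemma corner_powers_small a r q p y (e : R) : 0 < e ->
  star y = y -> star p = q -> p * q + y * y = y -> p * a + y * r = 0 ->
  exists k, n2 (y ^+ k.+1) <= 2 * n2 (r - 1) + e.
Proof.
move=> e0 sy sp Ey Ear; have [C C0 aC] := vN_bound a.
have yle f := (corner_bounds f sy sp Ey).1; have qle f := (corner_bounds f sy sp Ey).2.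
have d0 : 0 < e / (2 * C) by rewrite divr_gt0 ?mulr_gt0.
have [||n nP] := @nonincreasing_gap R (fun k => n2 (y ^+ k)) _ _ _ d0.
- by move=> k; rewrite /n2 exprS vN_mulE.
- by move=> k; exact: n2_ge0.
have gap := nP n n.+1 (leqnn _) (leqnSn _).
pose w := (y ^+ n.+1) delta; pose t := n2 (y ^+ n.+1).
have t0 : 0 <= t by exact: n2_ge0.
exists n; rewrite -/t.
have E1 : ip (star (1 - r) w) w = ip ((y ^+ (n.+1 + n.+1)) delta) ((1 - r) delta).
  have sym := starX y n.+1; rewrite sy in sym.
  have w2 : w = star (y ^+ n.+1) delta by rewrite sym.
  rewrite [X in ip _ X = _]w2 starPr.
  rewrite -[LHS]/(tau (y ^+ n.+1 * (star (1 - r) * y ^+ n.+1))) tauC -mulrA -exprD.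
  by rewrite /tau vN_mulE starP.
have E2 : ip (star r w) w = - ip (q ((y ^+ n) delta)) (a w).
  have : star (p * a + y * r) = 0 by rewrite Ear star0.
  rewrite starD !starM sp sy => /eqP; rewrite addrC addr_eq0 => /eqP E.
  rewrite /w exprS -vN_mulE mulrA E !mulNr vN_oppE ipNl -mulrA !vN_mulE.
  by rewrite starP.
have tE : t = ip (star (1 - r) w) w + ip (star r w) w.
  by rewrite -ipDl -vN_addE -starD subrK star1 vN_oneE ip_sqn.
have B1 : ip (star (1 - r) w) w ^+ 2 <= t * n2 (r - 1).
  rewrite E1; apply: le_trans (ip_CS _ _) _.
  have -> : sqn ((1 - r) delta) = n2 (r - 1) by rewrite /n2 -opprB vN_oppE sqnN.
  rewrite ler_wpM2r ?n2_ge0 // exprD vN_mulE.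
  rewrite -/w /t /n2 -/w; elim: (n.+1 : nat) => [|d IH]; first by rewrite expr0 vN_oneE.
  by rewrite exprS vN_mulE; exact: le_trans (yle _) IH.
have B2 : ip (star r w) w ^+ 2 <= (e / (2 * C)) * (C * t).
  rewrite E2 sqrrN; apply: (ip_le d0); last exact: aC.
  apply: le_trans (qle _) _; rewrite -vN_mulE -exprS; exact: gap.
move: tE B1 B2 t0 (n2_ge0 (r - 1)) e0.
have -> : e / (2 * C) * (C * t) = t * (e / 2) by field; rewrite gt_eqF.
move: (ip _ _) (ip _ _) (n2 (r - 1)) => z x b; move: t; clear => t tE xb ze t0 b0 e0.
have : t * t <= t * (2 * b + e).
  have : (x + z) ^+ 2 <= 2 * x ^+ 2 + 2 * z ^+ 2 by have := sqr_ge0 (x - z); nra.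
  by rewrite -tE expr2; nra.
have [->|tn0] := eqVneq t 0; last by rewrite ler_pM2l // lt_def tn0.
lra.
Qed.

(** [1 - (1 - s)^(k+1)] is a left multiple of the corner [s], so the relation
    [s a + q r = 0] passes to it; its distance to [1] is controlled by the moments
    of the opposite corner [y]. *)
Lemma ore_approx a r (e : R) : 0 < e ->
  exists s b, s * a = b * r /\ n2 (s - 1) <= 2 * n2 (r - 1) + e.
Proof.
move=> e0.
have [s [q [p [y [[ss sp sy] [Es Eq Ey] sa pa ty]]]]] := block_projection a r.
have [k kP] := corner_powers_small e0 sy sp Ey pa.
pose z := 1 - s; have sz : star z = z by rewrite starB star1 ss.
have sE : 1 - z = s by rewrite subKr.
have T (x w : N) : 1 - w * x = 1 - w + w * (1 - x).
  by rewrite mulrBr mulr1 addrA subrK.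
have [c cE] : exists c, 1 - z ^+ k.+1 = c * s.
  elim: (k.+1) => [|d [c cE]]; first by exists 0; rewrite subrr mul0r.
  exists (c + z ^+ d); rewrite mulrDl -cE exprSr.
  by rewrite T sE.
exists (c * s), (- (c * q)); split.
  by move/eqP: sa; rewrite addr_eq0 -mulrA => /eqP ->; rewrite mulrN mulrA mulNr.
apply: le_trans kP.
have -> : n2 (c * s - 1) = n2 (z ^+ k.+1).
  by rewrite -cE addrC addKr /n2 vN_oppE sqnN.
rewrite (n2X_self _ sy) (n2X_self _ sz) addSn (corner_moments _ Es Eq Ey).
by rewrite gerDr -addrA -opprD subr_le0.
Qed.

End Ore.

(** * Torsion elements of modules over the von Neumann algebra *)

Section Torsion.
Variables (R : realType) (G : groupType).
Local Notation N := (group_vN R G).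
Implicit Types (a b r s S T : N).

Lemma n2D_le S T : n2 (S + T) <= 2 * n2 S + 2 * n2 T.
Proof. exact: sqnD_le. Qed.

Lemma n2N T : n2 (- T) = n2 T.
Proof. by rewrite /n2 vN_oppE sqnN. Qed.

Lemma n2_eq0 T : n2 T <= 0 -> T = 0.
Proof. by move=> /sqn_eq0/vN_delta0. Qed.

Lemma n2_mulr_le r : exists2 C : R, 0 < C & forall T, n2 (T * r) <= C * n2 T.
Proof.
have [C C0 rC] := vN_bound (star r); exists C => // T.
by rewrite -n2_star starM -(n2_star T); exact: rC.
Qed.

Lemma n2_mull_le r : exists2 C : R, 0 < C & forall T, n2 (r * T) <= C * n2 T.
Proof. by have [C C0 rC] := vN_bound r; exists C => // T; exact: rC. Qed.

(** Right multiplication by [a] is bounded for the 2-norm, so [a = (1 - r) a] is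
    arbitrarily small. *)
Lemma approx_annihilator a :
  (forall e : R, 0 < e -> exists2 r, n2 (r - 1) <= e & r * a = 0) -> a = 0.
Proof.
move=> ra; have [C C0 aC] := n2_mulr_le a.
apply/n2_eq0/(@le0_of_le_eps _ _ C) => e /ra[r re ra0].
have -> : a = - ((r - 1) * a) by rewrite mulrBl ra0 mul1r sub0r opprK.
by rewrite n2N; apply: le_trans (aC _) _; rewrite ler_pM2l.
Qed.

Variables (V : lmodType N) (P : V -> Prop).
Hypothesis P_add : forall x y, P x -> P y -> P (x + y).
Hypothesis P_scale : forall a x, P x -> P (a *: x).

(** [x] is torsion modulo [P]: its annihilator modulo [P] contains elements
    arbitrarily close to [1].  For projections [r] this is the local criterion for
    vanishing von Neumann dimension. *)
Definition torsion_mod (x : V) : Prop :=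
  forall e : R, 0 < e -> exists2 r, n2 (r - 1) <= e & P (r *: x).

Lemma torsion_mod_in x : P x -> torsion_mod x.
Proof.
move=> Px e e0; exists 1; last exact: P_scale.
by rewrite subrr /n2 vN_zeroE sqn0 ltW.
Qed.

(** If [r] kills [x] and [s a = b r], then [s] kills [a x]. *)
Lemma torsion_modZ a x : torsion_mod x -> torsion_mod (a *: x).
Proof.
move=> xT e e0; have e4 : 0 < e / 4 by rewrite divr_gt0.
have e2 : 0 < e / 2 by rewrite divr_gt0.
have [r re Pr] := xT _ e4; have [s [b [sab se]]] := ore_approx a r e2.
exists s; first by apply: le_trans se _; lra.
by rewrite scalerA sab -scalerA; exact: P_scale.
Qed.

(** Transitivity: if [s] kills [r x], then [s r] kills [x], and [s r] is close to [1]
    when [s] is chosen after [r]. *)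
Lemma torsion_mod_dense x :
  (forall e : R, 0 < e -> exists2 r, n2 (r - 1) <= e & torsion_mod (r *: x)) ->
  torsion_mod x.
Proof.
move=> xT e e0; have e4 : 0 < e / 4 by rewrite divr_gt0.
have [r re rT] := xT _ e4; have [C C0 rC] := n2_mulr_le r.
have d0 : 0 < e / 4 / C by rewrite divr_gt0.
have [s se Ps] := rT _ d0; exists (s * r); last by rewrite -scalerA.
have -> : s * r - 1 = (s - 1) * r + (r - 1) by rewrite mulrBl mul1r addrA subrK.
apply: le_trans (n2D_le _ _) _.
have : n2 ((s - 1) * r) <= e / 4.
  by apply: le_trans (rC _) _; rewrite mulrC -ler_pdivlMr.
by move: (n2 _) (n2 _) re; clear => u v ? ?; lra.
Qed.

Lemma torsion_modD x y : torsion_mod x -> torsion_mod y -> torsion_mod (x + y).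
Proof.
move=> xT yT; apply: torsion_mod_dense => e /xT [r re Pr]; exists r => //.
rewrite scalerDr => d d0; have [s sd Ps] := torsion_modZ r yT d0.
exists s => //; rewrite scalerDr; apply: P_add => //; exact: P_scale.
Qed.

Lemma torsion_mod_sum (I : Type) (t : seq I) (F : I -> V) :
  P 0 -> (forall i, torsion_mod (F i)) -> torsion_mod (\sum_(i <- t) F i).
Proof.
move=> P0 FT; elim/big_rec: _ => [|i x _ xT]; first exact: torsion_mod_in.
exact: torsion_modD.
Qed.

End Torsion.

(** * Translations by elements of infinite order *)
Section Translations.
Variables (R : realType) (G : groupType).
Local Notation N := (group_vN R G).
Local Notation delta := (l2_delta1 R G).
Local Notation L := (vN_translation R).
Implicit Types (g h x y : G).

Lemma left_translateE g (f : l2 R G) x : L g f x = f (g^-1 * x)%g.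
Proof. by []. Qed.

Lemma translationM g h : L (g * h)%g = L g * L h.
Proof.
apply: vN_eqP => f; apply: l2_eqP => x.
by rewrite vN_mulE !left_translateE invgM mulgA.
Qed.

Lemma translation1 : L (1%g : G) = 1.
Proof.
by apply: vN_eqP => f; apply: l2_eqP => x; rewrite left_translateE invg1 mul1g.
Qed.

Lemma translationX g k : L (g ^+ k)%g = L g ^+ k.
Proof.
elim: k => [|k IH]; first by rewrite expg0 translation1.
by rewrite expgS translationM IH exprS.
Qed.

Lemma translation_delta g : L g delta = pt R g.
Proof.
apply: l2_eqP => x; rewrite left_translateE ptE; have := ptE R 1%g (g^-1 * x)%g.
rewrite /pt right_translateE invg1 mulg1 => ->; congr (_%:R); congr nat_of_bool.
by apply/eqP/eqP => [E|->]; [rewrite -[x](mulVKg g) E mulg1 | rewrite mulVg].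
Qed.

Lemma ip_pt_pt x y : ip (pt R x) (pt R y) = (x == y)%:R.
Proof.
rewrite -[pt R y]scale1r ip_pt ptE eq_sym /cdot /=.
by case: (x == y) => /=; rewrite !mulr0 ?mulr1 ?mulr0 addr0.
Qed.

Definition infinite_order g : Prop := forall k, (g ^+ k)%g = 1%g -> k = 0%N.

Lemma expg_inj_infinite g i j : infinite_order g -> (g ^+ i = g ^+ j)%g -> i = j.
Proof.
move=> gi; wlog ij : i j / (i <= j)%N => [W E|].
  by have [/W|/ltnW/W] := leqP i j; [exact | move=> W'; exact/esym/W'].
move=> gij; have : (g ^+ (j - i) = 1)%g.
  by apply: (mulIg (g ^+ i)%g); rewrite -expgnDr subnK // mul1g gij.
move=> /gi /eqP; rewrite subn_eq0 => ji.
by apply/eqP; rewrite eqn_leq ij.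
Qed.

(** The translates [pt (g^j)] are orthonormal. *)
Lemma n2_power_sum g k : infinite_order g -> n2 (\sum_(j < k) L g ^+ j) = k%:R.
Proof.
move=> gi; rewrite /n2; elim: k => [|k IH]; first by rewrite big_ord0 vN_zeroE sqn0.
rewrite big_ord_recr vN_addE sqnD IH -translationX translation_delta sqn_pt.
rewrite vN_sumE ip_suml big1 ?mulr0 ?addr0 -?natrS // => [|j _].
  by rewrite mulrSr.
rewrite -translationX translation_delta ip_pt_pt.
case: eqP => // /(expg_inj_infinite gi) jk.
by have := ltn_ord j; rewrite (jk : nat_of_ord j = k) ltnn.
Qed.

Lemma power_sum_factor g k :
  exists c : N, k%:R - \sum_(j < k) L g ^+ j = c * (L g - 1).
Proof.
elim: k => [|k [c cE]]; first by exists 0; rewrite big_ord0 subrr mul0r.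
have [d dE] : exists d, 1 - L g ^+ k = d * (L g - 1).
  elim: k {c cE} => [|k [d dE]]; first by exists 0; rewrite subrr mul0r.
  exists (d - L g ^+ k); rewrite mulrBl -dE exprSr mulrBr mulr1.
  by rewrite opprB addrA subrK.
exists (c + d); rewrite mulrDl -cE -dE big_ord_recr /= mulrSr.
by rewrite opprD addrACA.
Qed.

(** [X] is the average of the first [k] powers of [g] for a large [k]: a mean of [k]
    orthonormal translates has squared norm [1/k]. *)
Lemma small_average g (e : R) : infinite_order g -> 0 < e ->
  exists X : N, [/\ n2 X <= e, exists c, 1 - X = c * (L g - 1)
    & forall b, b * L g = b -> b * X = b].
Proof.
move=> gi e0.
pose k := (Num.truncn e^-1).+1.
have k0 : 0 < k%:R :> R by rewrite ltr0n.
have ke : k%:R^-1 <= e.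
  rewrite -[leRHS]invrK lef_pV2 ?posrE ?invr_gt0 //.
  by apply/ltW; rewrite truncnS_gt.
have [T TE] := @vN_scalar R G k%:R^-1.
have Tk : T * k%:R = 1.
  have kE f : (k%:R : N) f = Complex (k%:R : R) 0 *: f.
    elim: k {k0 ke T TE} => [|k IH]; first by rewrite scale0r.
    rewrite mulrSr vN_addE IH vN_oneE -{2}[f]scale1r -scalerDl; congr (_ *: f).
    by apply/eqP; rewrite eq_complex /= addr0 mulrSr !eqxx.
  apply: vN_eqP => f; rewrite vN_mulE TE kE scalerA vN_oneE -[RHS]scale1r; congr (_ *: f).
  apply/eqP; rewrite eq_complex /= !mul0r !mulr0 subr0 addr0 (mulVf (lt0r_neq0 k0)).
  by rewrite !eqxx.
have TC b : T * b = b * T.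
  by apply: vN_eqP => f; rewrite !vN_mulE !TE vN_appZ.
pose A : N := \sum_(j < k) L g ^+ j.
have nA : n2 A = k%:R by exact: n2_power_sum.
exists (T * A); split.
- rewrite /n2 vN_mulE TE sqnZ -/(n2 A) nA /complex_sqnorm /= expr0n addr0.
  by rewrite expr2 -mulrA (mulVf (lt0r_neq0 k0)) mulr1.
- have [c cE] := power_sum_factor g k.
  by exists (T * c); rewrite -mulrA -cE mulrBr Tk.
- move=> b bL; rewrite mulrA -TC -mulrA.
  have -> : b * A = b * k%:R.
    rewrite /A mulr_sumr (eq_bigr (fun=> b)) ?sumr_const ?card_ord ?mulr_natr //.
    by move=> j _; elim: (j : nat) => [|d IH]; rewrite ?mulr1 // exprSr mulrA IH.
  by rewrite mulrA TC -mulrA Tk mulr1.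
Qed.

Lemma translation_sub1_dense g (e : R) : infinite_order g -> 0 < e ->
  exists c : N, n2 (c * (L g - 1) - 1) <= e.
Proof.
move=> gi e0; have [X [Xe [c cE] _]] := small_average gi e0; exists c.
by rewrite -cE addrAC subrr sub0r n2N.
Qed.

(** If [b g = b], then [b] is also fixed by averages of powers of [g], which are
    small. *)
Lemma translation_sub1_regular g (b : N) : infinite_order g -> b * L g = b -> b = 0.
Proof.
move=> gi bL; have [C C0 bC] := n2_mull_le b.
apply/n2_eq0/(@le0_of_le_eps _ _ C) => e e0.
have [X [Xe _ /(_ b bL) bX]] := small_average gi e0.
by rewrite -bX; apply: le_trans (bC _) _; rewrite ler_pM2l.
Qed.

End Translations.

(** * The bar complex in low degrees *)

Section BarComplex.
Variables (R : realType) (G : groupType).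
Local Notation N := (group_vN R G).
Local Notation L := (vN_translation R).
Local Notation chain := (G -> N^o).
Implicit Types (a b r : N) (g h x : G).

Lemma finitely_supported_single g a : finitely_supported (bar_single g a : chain).
Proof.
apply: (@sub_finite_set _ _ [set g]); last exact: finite_set1.
by move=> x /=; rewrite /bar_single; case: eqP => // ->.
Qed.

Lemma bar_singleZ a b g : a *: (bar_single g b : chain) = bar_single g (a * b).
Proof.
by apply/funext => x; rewrite /bar_single fctE; case: (x == g) => //; exact: mulr0.
Qed.

Lemma bar_singleE a g : bar_single g a = a *: (bar_single g 1 : chain).
Proof. by rewrite bar_singleZ mulr1. Qed.

Lemma bar_d1_lin a (c c' : chain) : finitely_supported c -> finitely_supported c' ->
  bar_d1 (a *: c + c') = a * bar_d1 c + bar_d1 c'.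
Proof.
move=> fc fc'; have E := @bar_sum_lin R G G N^o
  (fun g (x : N) => x * vN_translation R g - x) a c c' _ fc fc'.
apply: etrans (E _) (erefl _) => g b u v.
rewrite mulrDl opprD scalerBr -mulrA; exact: addrACA.
Qed.

Lemma bar_d2_lin a (c c' : G * G -> N^o) :
  finitely_supported c -> finitely_supported c' ->
  bar_d2 (a *: c + c') = a *: bar_d2 c + bar_d2 c'.
Proof.
move=> fc fc'; have /= := @bar_sum_lin R G (G * G)%type chain
  (fun p (x : N) => bar_single p.2 (x * vN_translation R p.1)
     - bar_single (p.1 * p.2)%g x + bar_single p.1 x) a c c' _ fc fc'.
rewrite -/(bar_d2 c) -/(bar_d2 c'); apply=> p b v w.
rewrite mulrDl -mulrA; apply/funext => x; rewrite !fctE /bar_single.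
have E (t : bool) (v' w' : N) :
    (if t then b * v' + w' else 0) = b * (if t then v' else 0) + (if t then w' else 0).
  by case: t; rewrite ?mulr0 ?addr0.
rewrite !E.
have F (p1 p2 p3 q1 q2 q3 : N) : (b * p1 + q1) - (b * p2 + q2) + (b * p3 + q3)
    = b * (p1 - p2 + p3) + (q1 - q2 + q3).
  by rewrite mulrDr mulrBr opprD (addrACA (b * p1) q1) (addrACA (b * p1 - b * p2)).
exact: F.
Qed.

Lemma fsbig_single (T : choiceType) (V : lmodType N) (F : T -> V) t :
  (forall u, u <> t -> F u = 0) -> \sum_(u \in [set: T]) F u = F t.
Proof.
move=> F0; rewrite -(@fsbig_set1 _ 0 +%R _ t F).
apply/esym/fsbig_widen => // u [_ ut] /=.
exact: F0.
Qed.

Lemma bar_d1_single g a : bar_d1 (bar_single g a) = a * L g - a.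
Proof.
rewrite /bar_d1 (@fsbig_single G N^o _ g) /bar_single ?eqxx // => x /eqP/negbTE xg.
by rewrite xg mul0r subrr.
Qed.

Lemma bar_d2_single g h a :
  bar_d2 (fun p => if p == (g, h) then a else 0) =
  bar_single h (a * L g) - bar_single (g * h)%g a + bar_single g a.
Proof.
rewrite /bar_d2 (@fsbig_single (G * G)%type chain _ (g, h)) ?eqxx //= => p /eqP/negbTE pgh.
rewrite pgh mul0r; apply/funext => x.
by rewrite !fctE /bar_single !if_same subrr addr0.
Qed.

Lemma bar_d1_0 : bar_d1 (0 : chain) = 0.
Proof. by rewrite /bar_d1 fsbig1 // => g _; rewrite (_ : (0 : chain) g = 0) // mul0r subrr. Qed.

Lemma finitely_supportedD (T : Type) (c c' : T -> N^o) :
  finitely_supported c -> finitely_supported c' -> finitely_supported (c + c').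
Proof. by move=> fc fc'; have := finitely_supported_lin 1 fc fc'; rewrite scale1r. Qed.

Lemma finitely_supportedN (T : Type) (c : T -> N^o) :
  finitely_supported c -> finitely_supported (- c).
Proof.
move=> fc; have := finitely_supported_lin (-1) fc (finitely_supported0 R G T).
by rewrite scaleN1r addr0.
Qed.

Lemma bar_d1D (c c' : chain) : finitely_supported c -> finitely_supported c' ->
  bar_d1 (c + c') = bar_d1 c + bar_d1 c'.
Proof. by move=> fc fc'; have := bar_d1_lin 1 fc fc'; rewrite scale1r mul1r. Qed.

Lemma bar_d1N (c : chain) : finitely_supported c -> bar_d1 (- c) = - bar_d1 c.
Proof.
move=> fc; have := bar_d1_lin (-1) fc (finitely_supported0 R G G).
by rewrite scaleN1r !addr0 bar_d1_0 addr0 mulN1r.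
Qed.

Lemma bar_sum_finite (T : choiceType) (V : lmodType N) (F : T -> N -> V) (c : T -> N^o) :
  (forall t, F t 0 = 0) -> finitely_supported c -> exists s : seq T,
  \sum_(t \in [set: T]) F t (c t) = \sum_(t <- s) F t (c t).
Proof.
move=> F0 fc; exists (fset_set [set t | c t <> 0]).
rewrite -fsbig_finite //; apply/esym/fsbig_widen => // t [_ /contrapT ct] /=.
by rewrite ct F0.
Qed.

(** A finitely supported 2-chain is a finite sum of single terms, on which
    [d1 (d2 (a [g|h]))] cancels. *)
Lemma bar_d1d2 (c : G * G -> N^o) : finitely_supported c ->
  finitely_supported (bar_d2 c) /\ bar_d1 (bar_d2 c) = 0.
Proof.
move=> fc; rewrite /bar_d2; have [|s ->] := @bar_sum_finite (G * G)%type chain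
  (fun p (x : N) => bar_single p.2 (x * vN_translation R p.1)
     - bar_single (p.1 * p.2)%g x + bar_single p.1 x) c _ fc.
  move=> p; rewrite mul0r; apply/funext => x.
  by rewrite !fctE /bar_single !if_same subrr addr0.
elim: s => [|[g h] s [fs ds]].
  by rewrite big_nil bar_d1_0; split=> //; exact: finitely_supported0.
rewrite big_cons /=; set a := c (g, h).
have f1 := finitely_supported_single h (a * L g).
have f2 := finitely_supportedN (finitely_supported_single (g * h)%g a).
have f3 := finitely_supported_single g a.
have f12 := finitely_supportedD f1 f2; have f123 := finitely_supportedD f12 f3.
split; first exact: finitely_supportedD.
rewrite !bar_d1D // bar_d1N ?bar_d1_single; last exact: finitely_supported_single.
rewrite ds addr0 translationM mulrA.
have F (u v w : N) : (u - v) - (u - w) + (v - w) = 0.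
  by rewrite opprB [u - v + _]addrC [w - u + _]addrA subrK addrA subrK subrr.
exact: F.
Qed.

Lemma chain_sum (c : chain) : finitely_supported c ->
  exists s : seq G, c = \sum_(g <- s) c g *: (bar_single g 1 : chain).
Proof.
move=> fc; have := fc => /finite_fsetP[F FE].
exists F; apply/funext => x.
have E (s : seq G) : (\sum_(g <- s) c g *: (bar_single g 1 : chain)) x =
   \sum_(g <- s) (if x == g then c g else 0).
  elim: s => [|g s IH]; rewrite ?big_nil // !big_cons fctE IH; congr (_ + _).
  by rewrite -bar_singleE.
rewrite E; have [xF|xF] := boolP (x \in F).
  rewrite (big_fsetD1 x) //= eqxx big_seq big1 ?addr0 // => g.
  by rewrite !inE eq_sym => /andP[/negbTE ->].
rewrite big_seq big1 => [|g gF].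
  by apply: contrapT => cx; move/negP: xF; apply; move: cx; rewrite -[_ <> _]/([set t | c t <> 0] x) FE.
by case: eqP xF => // ->; rewrite gF.
Qed.

End BarComplex.

(** * A vanishing criterion for the first l2-Betti number *)

Section Criterion.
Variables (R : realType) (G : groupType) (e : G).
Local Notation N := (group_vN R G).
Local Notation L := (vN_translation R).
Local Notation chain := (G -> N^o).
Local Notation gen g := (bar_single g (1 : N) : chain).
Implicit Types (a b r : N) (g h x : G).

(** Working modulo [[e]] makes [[e]] itself torsion, from which torsion spreads to the
    chains of all group elements. *)
Definition boundary_mod (c : chain) : Prop :=
  exists b, exists2 s : G * G -> N^o, finitely_supported s & c = b *: (gen e) + bar_d2 s.

Lemma boundary_modD c c' : boundary_mod c -> boundary_mod c' -> boundary_mod (c + c').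
Proof.
move=> [b [s fs ->]] [b' [s' fs' ->]]; exists (b + b'), (s + s').
  exact: finitely_supportedD.
have := bar_d2_lin 1 fs fs'; rewrite !scale1r => ->.
by rewrite scalerDl addrACA.
Qed.

Lemma bar_d2_0 : bar_d2 (0 : G * G -> N^o) = 0.
Proof.
have f0 := finitely_supported0 R G (G * G)%type.
by have := bar_d2_lin (-1) f0 f0; rewrite scaler0 addr0 scaleN1r addNr.
Qed.

Lemma boundary_modZ a c : boundary_mod c -> boundary_mod (a *: c).
Proof.
move=> [b [s fs ->]]; have f0 := finitely_supported0 R G (G * G)%type.
exists (a * b), (a *: s); first by have := finitely_supported_lin a fs f0; rewrite addr0.
have := bar_d2_lin a fs f0; rewrite addr0 bar_d2_0 addr0 => ->.
by rewrite scalerDr scalerA.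
Qed.

Lemma boundary_mod_d2 (s : G * G -> N^o) : finitely_supported s -> boundary_mod (bar_d2 s).
Proof. by move=> fs; exists 0, s => //; rewrite scale0r add0r. Qed.

Local Notation tor := (torsion_mod boundary_mod).

Lemma tor_d2 s : finitely_supported s -> tor (bar_d2 s).
Proof. by move=> fs; apply: torsion_mod_in; [exact: boundary_modZ | exact: boundary_mod_d2]. Qed.

(** The boundary of [[g|h]] expresses that [g -> [g]] is a crossed homomorphism. *)
Lemma cross_relation g h :
  exists2 c, tor c & (gen (g * h)%g) = L g *: (gen h) + (gen g) - c.
Proof.
pose s : G * G -> N^o := fun p => if p == (g, h) then 1 else 0.
have fs : finitely_supported s.
  apply: (@sub_finite_set _ _ [set (g, h)]); last exact: finite_set1.
  by move=> x /=; rewrite /s; case: eqP => // ->.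
exists (bar_d2 s); first exact: tor_d2.
rewrite bar_d2_single mul1r -bar_singleE.
have F (V : zmodType) (u v w : V) : v = u + w - (u - v + w).
  by rewrite opprD opprB addrACA subrr addr0 addrC subrK.
exact: F.
Qed.

Lemma torD c c' : tor c -> tor c' -> tor (c + c').
Proof. exact: torsion_modD boundary_modD boundary_modZ _ _. Qed.

Lemma torZ a c : tor c -> tor (a *: c).
Proof. exact: torsion_modZ boundary_modZ _ _. Qed.

Lemma torB c c' : tor c -> tor c' -> tor (c - c').
Proof. by move=> tc tc'; apply: torD => //; rewrite -scaleN1r; exact: torZ. Qed.

Lemma tor_e : tor (gen e).
Proof.
apply: torsion_mod_in; first exact: boundary_modZ.
exists 1, 0; first exact: finitely_supported0.
by rewrite bar_d2_0 addr0 scale1r.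
Qed.

Lemma torM g h : tor (gen g) -> tor (gen h) -> tor (gen (g * h)%g).
Proof.
move=> tg th; have [c tc ->] := cross_relation g h.
by apply: torB tc; apply: torD => //; exact: torZ.
Qed.

Lemma tor1 : tor (gen (1%g : G)).
Proof.
have [c tc] := cross_relation 1%g 1%g; rewrite mulg1 translation1 scale1r.
by move=> /eqP; rewrite -addrA eq_sym -subr_eq0 addrAC subrr add0r subr_eq0 => /eqP ->.
Qed.

Lemma torV g : tor (gen g) -> tor (gen (g^-1)%g).
Proof.
move=> tg; have [c tc] := cross_relation (g^-1)%g g; rewrite mulVg => E.
have -> : (gen (g^-1)%g) = (gen 1%g) - L g^-1%g *: (gen g) + c.
  by rewrite E addrAC subrK addrC addKr.
by apply: torD => //; apply: torB; [exact: tor1 | exact: torZ].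
Qed.

(** The two relations for [g h = h g] give [(g - 1) [h] = (h - 1) [g]], and [N (g - 1)]
    comes arbitrarily close to [1]. *)
Lemma tor_commute g h : infinite_order g -> (g * h = h * g)%g ->
  tor (gen g) -> tor (gen h).
Proof.
move=> gi gh tg; have [c tc E] := cross_relation g h.
have [c' tc' E'] := cross_relation h g.
have T : tor ((L g - 1) *: (gen h)).
  have -> : (L g - 1) *: (gen h) = L h *: (gen g) - (gen g) + (c - c').
    have F (V : zmodType) (p q u v z w : V) : p + q - z = u + v - w ->
        p - v = u - q + (z - w).
      move=> pq; have -> : p - v = (p + q - z) + (z - q - v).
        by rewrite !addrA subrK addrK.
      by rewrite pq (AC (3*3)%AC ((1*5)*(4*3)*(2*6))%AC) /= subrr addr0.
    by rewrite scalerBl scale1r; apply: F; rewrite -E -E' gh.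
  apply: torD; last exact: torB.
  by apply: torB => //; exact: torZ.
apply: torsion_mod_dense => d d0; have [b bd] := translation_sub1_dense gi d0.
by exists (b * (L g - 1)) => //; rewrite -scalerA; exact: torZ.
Qed.

Hypothesis e_infinite : infinite_order e.

(** Applying [d1] to [r z = b [e] + d2 s] shows that the coefficient [b] is killed by
    [e - 1], hence is zero. *)
Lemma torsion_cycle (z : chain) (d : R) : finitely_supported z -> bar_d1 z = 0 ->
  tor z -> 0 < d -> exists2 r, n2 (r - 1) <= d &
  exists2 s, finitely_supported s & r *: z = bar_d2 s.
Proof.
move=> fz dz tz d0; have [r rd [b [s fs E]]] := tz _ d0; exists r => //; exists s => //.
suff b0 : b = 0 by rewrite E b0 scale0r add0r.
apply: (translation_sub1_regular e_infinite).
have f0 := finitely_supported0 R G G.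
have := bar_d1_lin r fz f0; rewrite !addr0 bar_d1_0 addr0 dz mulr0 E.
have [fd2 d2] := bar_d1d2 fs.
rewrite -bar_singleE bar_d1D //; last exact: finitely_supported_single.
by rewrite bar_d1_single d2 addr0 => /eqP; rewrite subr_eq0 => /eqP.
Qed.

Hypothesis generated : forall S : G -> Prop,
  S e -> S 1%g -> (forall g h, S g -> S h -> S (g * h)%g) ->
  (forall g, S g -> S g^-1%g) ->
  (forall g h, S g -> infinite_order g -> (g * h = h * g)%g -> S h) ->
  forall g, S g.

Lemma tor_all g : tor (gen g).
Proof.
move: g; apply: generated; [exact: tor_e | exact: tor1 | exact: torM | exact: torV |].
by move=> g h tg gi gh; exact: tor_commute gi gh tg.
Qed.

(** Every basis chain [[g]] is torsion modulo [[e]] and the boundaries, hence so is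
    every chain; for cycles [torsion_cycle] removes [[e]]. *)
Lemma H1_torsion (x : vN_H1 R G) (d : R) : 0 < d ->
  exists2 r, n2 (r - 1) <= d & r *: x = 0.
Proof.
move=> d0; pose z := repr x : bar_cycles R G.
have /asboolP[fz dz] := bar_cycleP z.
have tz : tor (bar_cycle_val z).
  have [s ->] := chain_sum fz; apply: torsion_mod_sum.
  - exact: boundary_modD.
  - exact: boundary_modZ.
  - by have := boundary_modZ 0 (boundary_mod_d2 (finitely_supported0 _ _ _)); rewrite scale0r.
  - by move=> g; apply: torZ; exact: tor_all.
have [r rd [s fs E]] := torsion_cycle fz dz tz d0; exists r => //.
have rz : bar_boundary (r *: z) by apply/asboolP; exists s.
pose pi := \pi_(Quotient.quot (lmod_quot_pred (@bar_boundary_submod R G)))%qT.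
have -> : r *: x = pi (r *: z) by [].
have -> : 0 = pi 0 :> vN_H1 R G by rewrite /pi raddf0.
by apply/eqP; rewrite /pi -Quotient.idealrBE subr0.
Qed.

(** A finitely generated projective submodule of [H_1] has each row of its idempotent
    killed by elements of [N] close to [1], so the idempotent is [0]. *)
Theorem l2_betti1_eq0 : l2_betti1 R G = 0%E.
Proof.
apply/eqP; rewrite eq_le; apply/andP; split.
  apply: ge_ereal_sup => _ [n [A [phi [AA inj ->]]]].
  have A0 : A = 0.
    apply/matrixP => i j; rewrite mxE; apply: approx_annihilator => d d0.
    pose x := row i A; have xA : x *m A = x by rewrite /x -row_mul AA.
    have [r rd rx] := H1_torsion (phi x) d0; exists r => //.
    have : r *: x = 0.
      by apply: inj; [rewrite -scalemxAl xA | rewrite linearZ].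
    by move=> /rowP/(_ j); rewrite !mxE.
  by rewrite A0 big1 // => i _; rewrite mxE.
apply: ereal_sup_ubound; exists 0%N, 0, (\0 : {linear 'rV[N]_0 -> vN_H1 R G}).
split; first exact: mul0mx.
  by move=> x <- _; exact: mulmx0.
by rewrite big_ord0.
Qed.

End Criterion.

(** * Commuting elementary matrices *)

Section ElementaryGroup.
Variables (n : nat) (A : nzRingType).
Implicit Types (i j k l : 'I_n) (r s : A) (g h : EL n A).

Lemma delta_mx_mul0 i j k l r s : j != k ->
  (r *: delta_mx i j) *m (s *: delta_mx k l) = 0 :> 'M[A]_n.
Proof.
move=> jk; apply/matrixP => u v; rewrite !mxE big1 // => m _; rewrite !mxE.
have [->|_] := eqVneq m j; last by rewrite andbF mulr0 mul0r.
by rewrite (negbTE jk) /= !mulr0.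
Qed.

Lemma elementary_mx_mul i j k l r s : j != k ->
  elementary_mx i j r *m elementary_mx k l s =
  1%:M + r *: delta_mx i j + s *: delta_mx k l.
Proof.
move=> jk; rewrite /elementary_mx mulmxDl mul1mx mulmxDr mulmx1 delta_mx_mul0 //.
by rewrite addr0 addrAC.
Qed.

Lemma elementary_commute i j k l r s g h : j != k -> i != l ->
  EL_val g = elementary_mx i j r -> EL_val h = elementary_mx k l s ->
  (g * h = h * g)%g.
Proof.
move=> jk il gE hE; apply: val_inj.
rewrite [LHS](_ : _ = EL_val g *m EL_val h) // [RHS](_ : _ = EL_val h *m EL_val g) //.
have li : l != i by rewrite eq_sym.
by rewrite gE hE !elementary_mx_mul // addrAC.
Qed.

Lemma elementary_pow i j r g m : i != j -> EL_val g = elementary_mx i j r ->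
  EL_val (g ^+ m)%g = elementary_mx i j (r *+ m).
Proof.
move=> ij gE; elim: m => [|m IH]; first by rewrite /elementary_mx mulr0n scale0r addr0.
rewrite expgS [LHS](_ : _ = EL_val g *m EL_val (g ^+ m)%g) // IH gE.
have ji : j != i by rewrite eq_sym.
by rewrite elementary_mx_mul // /elementary_mx mulrS scalerDl addrA.
Qed.

Lemma elementary_infinite_order i j g :
  (forall m : nat, m%:R = 0 :> A -> m = 0%N) -> i != j ->
  EL_val g = elementary_mx i j 1 -> infinite_order g.
Proof.
move=> char0 ij gE m gm; apply: char0.
have := elementary_pow m ij gE; rewrite gm => /matrixP/(_ i j).
by rewrite !mxE (negbTE ij) !eqxx mulr1 add0r => <-.
Qed.

Lemma EL_generated (S : EL n A -> Prop) :
  S 1%g -> (forall g h, S g -> S h -> S (g * h)%g) -> (forall g, S g -> S g^-1%g) ->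
  (forall i j r g, i != j -> EL_val g = elementary_mx i j r -> S g) ->
  forall g, S g.
Proof.
move=> S1 SM SV SE g; have /asboolP gEL := EL_valP g.
suff : forall M, in_EL M -> forall h, EL_val h = M -> S h by move=> /(_ _ gEL); exact.
move=> M; elim=> {M gEL}.
- by move=> i j r ij h; exact: SE.
- by move=> h h1; rewrite (_ : h = 1%g) //; exact: val_inj.
- move=> M1 M2 E1 IH1 E2 IH2 h hE.
  rewrite (_ : h = ELMatrix (asboolT E1) * ELMatrix (asboolT E2))%g; last exact: val_inj.
  by apply: SM; [exact: IH1 | exact: IH2].
- move=> M1 M2 E1 IH1 l1 r1 h hE.
  pose m : EL n A := ELMatrix (asboolT E1).
  have mh : (m * h = 1)%g by apply: val_inj; rewrite [LHS](_ : _ = M1 *m EL_val h) // hE.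
  rewrite (_ : h = m^-1)%g; first by apply: SV; exact: IH1.
  by rewrite -[RHS]mulg1 -mh mulKg.
Qed.

(** [E_ij(1)] commutes with every [E_kl(s)] such that [j != k] and [i != l]; for
    [n >= 3] these commutations connect all pairs of indices. *)
Lemma EL_commuting_chain (S : EL n A -> Prop) (i0 i1 i2 : 'I_n) :
  (forall m : nat, m%:R = 0 :> A -> m = 0%N) ->
  i0 != i1 -> i0 != i2 -> i1 != i2 ->
  (forall g h, S g -> infinite_order g -> (g * h = h * g)%g -> S h) ->
  (forall g, EL_val g = elementary_mx i0 i1 1 -> S g) ->
  forall i j r g, i != j -> EL_val g = elementary_mx i j r -> S g.
Proof.
move=> char0 d01 d02 d12 SC S01.
pose T i j := forall r g, EL_val g = elementary_mx i j r -> S g.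
have step i j k l : i != j -> j != k -> i != l ->
    (forall g, EL_val g = elementary_mx i j 1 -> S g) -> T k l.
  move=> ij jk il Sij r h hE; pose g : EL n A := ELMatrix (asboolT (in_EL_elementary 1 ij)).
  apply: (SC g h); first exact: Sij.
    exact: (@elementary_infinite_order i j).
  exact: (@elementary_commute i j k l 1 r g h jk il).
suff : forall i j, i != j -> T i j by move=> TT i j r g ij; exact: TT.
move=> i j ij; have [j0|j0] := eqVneq j i0.
  rewrite j0 in ij *.
  have T21 : T i2 i1 by apply: (step i0 i1).
  have T20 : T i2 i0 by apply: (step i2 i1) => //; rewrite 1?eq_sym //; exact: T21.
  by apply: (step i2 i0) => //; rewrite 1?eq_sym //; exact: T20.
have T0j : T i0 j by apply: (step i0 i1) => //; rewrite 1?eq_sym.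
by apply: (step i0 j) => //; rewrite 1?eq_sym //; exact: T0j.
Qed.

End ElementaryGroup.

Theorem corollary4p1 (R : realType) (n : nat) (A : nzRingType)
    (n_ge3 : (3 <= n)%N)
    (A_countable : countable [set: A])
    (A_char0 : forall m : nat, m%:R = 0 :> A -> m = 0%N) :
  l2_betti1 R (EL n A) = 0%E.
Proof.
pose i0 : 'I_n := Ordinal (ltn_trans (isT : (0 < 2)%N) n_ge3).
pose i1 : 'I_n := Ordinal (ltn_trans (isT : (1 < 2)%N) n_ge3).
pose i2 : 'I_n := Ordinal n_ge3.
have d01 : i0 != i1 by [].
pose e : EL n A := ELMatrix (asboolT (in_EL_elementary 1 d01)).
apply: (@l2_betti1_eq0 R _ e).
  exact: (elementary_infinite_order A_char0 d01).
move=> S Se S1 SM SV SC; apply: EL_generated => //.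
apply: (@EL_commuting_chain _ _ S i0 i1 i2) => // g gE.
by rewrite (_ : g = e) //; exact: val_inj.
Qed.
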